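(* Let $\gamma_1,\gamma_2,\gamma_3,\delta_1,\delta_2,\delta_3,x,y\in\mathbb{C}$ with $\operatorname{Re}\gamma_2>0$ and $\operatorname{Re}\gamma_3>0$, and let $\alpha_1,\dots,\alpha_4,\beta_1,\dots,\beta_4$ be positive real numbers. Then $$D_1\left(\begin{matrix}\gamma_1,\alpha_1,\beta_1;\gamma_2,\alpha_2;\gamma_3,\beta_2;\\ \delta_1,\alpha_3,\beta_3;\delta_2,\alpha_4;\delta_3,\beta_4;\end{matrix}\left|\begin{matrix}x\\ y\end{matrix}\right.\right)=\frac{\Gamma(\gamma_2+\gamma_3)}{\Gamma(\gamma_2)\Gamma(\gamma_3)}\int_0^1\xi^{\gamma_2-1}(1-\xi)^{\gamma_3-1}D_5\left(\begin{matrix}\gamma_1,\alpha_1,\beta_1;\gamma_2+\gamma_3,\alpha_2,\beta_2;\\ \delta_1,\alpha_3,\beta_3;\delta_2,\alpha_4;\delta_3,\beta_4;\end{matrix}\left|\begin{matrix}x\xi^{\alpha_2}\\ y(1-\xi)^{\beta_2}\end{matrix}\right.\right)d\xi.$$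
   Context: $(\gamma)_\lambda=\Gamma(\gamma+\lambda)/\Gamma(\gamma)$ for $\gamma\in\mathbb{C}$ and real $\lambda\ge0$. For complex $\gamma_i,\delta_i,x,y$ and positive real $\alpha_i,\beta_i$, $$D_1\left(\begin{matrix}\gamma_1,\alpha_1,\beta_1;\gamma_2,\alpha_2;\gamma_3,\beta_2;\\ \delta_1,\alpha_3,\beta_3;\delta_2,\alpha_4;\delta_3,\beta_4;\end{matrix}\left|\begin{matrix}x\\ y\end{matrix}\right.\right)=\sum_{m,n=0}^{\infty}\frac{(\gamma_1)_{\alpha_1 m+\beta_1 n}(\gamma_2)_{\alpha_2 m}(\gamma_3)_{\beta_2 n}}{\Gamma(\delta_1+\alpha_3 m+\beta_3 n)}\frac{x^m}{\Gamma(\delta_2+\alpha_4 m)}\frac{y^n}{\Gamma(\delta_3+\beta_4 n)},$$ $$D_5\left(\begin{matrix}\gamma_1,\alpha_1,\beta_1;\gamma_2,\alpha_2,\beta_2;\\ \delta_1,\alpha_3,\beta_3;\delta_2,\alpha_4;\delta_3,\beta_4;\end{matrix}\left|\begin{matrix}x\\ y\end{matrix}\right.\right)=\sum_{m,n=0}^{\infty}\frac{(\gamma_1)_{\alpha_1 m+\beta_1 n}(\gamma_2)_{\alpha_2 m+\beta_2 n}}{\Gamma(\delta_1+\alpha_3 m+\beta_3 n)}\frac{x^m}{\Gamma(\delta_2+\alpha_4 m)}\frac{y^n}{\Gamma(\delta_3+\beta_4 n)}.$$ The functions are considered at arguments in the region of absolute convergence of their defining series. *)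

(* Defs.v *)
From HB Require Import structures.
From mathcomp Require Import all_boot all_order all_algebra.
From mathcomp Require Import all_classical all_reals all_analysis.
From mathcomp Require Import complex.

Set Implicit Arguments.
Unset Strict Implicit.
Unset Printing Implicit Defensive.

Import Order.TTheory GRing.Theory Num.Theory.
Import numFieldNormedType.Exports.

Local Open Scope classical_set_scope.
Local Open Scope ring_scope.
Local Open Scope complex_scope.

(* R[i] carries no measurable structure: Lebesgue integrals and limits of
   complex-valued functions are taken on real and imaginary parts. *)

Definition cintegrable (R : realType) (D : set R) (f : R -> R[i]) : Prop :=
  (@lebesgue_measure R).-integrable D (fun t => (complex.Re (f t))%:E) /\
  (@lebesgue_measure R).-integrable D (fun t => (complex.Im (f t))%:E).

Definition cintegral (R : realType) (D : set R) (f : R -> R[i]) : R[i] :=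
  (\int[@lebesgue_measure R]_(t in D) complex.Re (f t)) +i*
  (\int[@lebesgue_measure R]_(t in D) complex.Im (f t)).

(* t^z = exp (z ln t) with the real logarithm, meant for t > 0. *)
Definition cpow (R : realType) (t : R) (z : R[i]) : R[i] :=
  (t `^ complex.Re z)%:C *
  (cos (complex.Im z * ln t) +i* sin (complex.Im z * ln t)).

(* Euler's integral, the Gamma function on the half-plane Re z > 0. *)
Definition Gamma_int (R : realType) (z : R[i]) : R[i] :=
  cintegral `]0, +oo[ (fun t : R => cpow t (z - 1) * (expR (- t))%:C).

(* Analytic continuation by Gamma (z + 1) = z Gamma z: the shift N is the
   least natural number with Re (z + N) > 0, so N = 0 when Re z > 0.  At the
   poles 0, -1, -2, ... the denominator vanishes, and since 0^-1 = 0 both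
   Gamma z and (Gamma z)^-1 are 0 there; for the reciprocal this is the value
   of the entire function 1 / Gamma. *)
Definition Gamma (R : realType) (z : R[i]) : R[i] :=
  let N := Num.truncn (1 - complex.Re z) in
  Gamma_int (z + N%:R) / \prod_(k < N) (z + k%:R).

Definition Gamma_pole (R : realType) (z : R[i]) : bool :=
  z == - (Num.truncn (- complex.Re z))%:R.

(* (g)_l = Gamma (g + l) / Gamma g.  When g is a pole of Gamma and l is a
   natural number, the quotient is read as its limit in g, the rising
   factorial g (g + 1) ... (g + l - 1); in particular (g)_0 = 1 for all g. *)
Definition pochhammer (R : realType) (g : R[i]) (l : R) : R[i] :=
  if Gamma_pole g && (l == (Num.truncn l)%:R)
  then \prod_(k < Num.truncn l) (g + k%:R)
  else Gamma (g + l%:C) / Gamma g.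

Definition abs_summable2 (R : realType) (a : nat -> nat -> R[i]) : Prop :=
  summable [set: nat * nat] (fun p => (ComplexField.Normc.normc (a p.1 p.2))%:E).

(* Limit of the square partial sums; under [abs_summable2] any other order of
   summation gives the same value. *)
Definition csum2 (R : realType) (a : nat -> nat -> R[i]) : R[i] :=
  limn (fun N => complex.Re (\sum_(m < N) \sum_(n < N) a m n)) +i*
  limn (fun N => complex.Im (\sum_(m < N) \sum_(n < N) a m n)).

Definition D1_term (R : realType)
    (g1 : R[i]) (a1 b1 : R) (g2 : R[i]) (a2 : R) (g3 : R[i]) (b2 : R)
    (d1 : R[i]) (a3 b3 : R) (d2 : R[i]) (a4 : R) (d3 : R[i]) (b4 : R)
    (x y : R[i]) (m n : nat) : R[i] :=
  pochhammer g1 (a1 * m%:R + b1 * n%:R) * pochhammer g2 (a2 * m%:R) *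
    pochhammer g3 (b2 * n%:R) / Gamma (d1 + (a3 * m%:R + b3 * n%:R)%:C) *
  (x ^+ m / Gamma (d2 + (a4 * m%:R)%:C)) *
  (y ^+ n / Gamma (d3 + (b4 * n%:R)%:C)).

Definition D1 (R : realType)
    (g1 : R[i]) (a1 b1 : R) (g2 : R[i]) (a2 : R) (g3 : R[i]) (b2 : R)
    (d1 : R[i]) (a3 b3 : R) (d2 : R[i]) (a4 : R) (d3 : R[i]) (b4 : R)
    (x y : R[i]) : R[i] :=
  csum2 (D1_term g1 a1 b1 g2 a2 g3 b2 d1 a3 b3 d2 a4 d3 b4 x y).

Definition D5_term (R : realType)
    (g1 : R[i]) (a1 b1 : R) (g2 : R[i]) (a2 b2 : R)
    (d1 : R[i]) (a3 b3 : R) (d2 : R[i]) (a4 : R) (d3 : R[i]) (b4 : R)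
    (x y : R[i]) (m n : nat) : R[i] :=
  pochhammer g1 (a1 * m%:R + b1 * n%:R) *
    pochhammer g2 (a2 * m%:R + b2 * n%:R) /
    Gamma (d1 + (a3 * m%:R + b3 * n%:R)%:C) *
  (x ^+ m / Gamma (d2 + (a4 * m%:R)%:C)) *
  (y ^+ n / Gamma (d3 + (b4 * n%:R)%:C)).

Definition D5 (R : realType)
    (g1 : R[i]) (a1 b1 : R) (g2 : R[i]) (a2 b2 : R)
    (d1 : R[i]) (a3 b3 : R) (d2 : R[i]) (a4 : R) (d3 : R[i]) (b4 : R)
    (x y : R[i]) : R[i] :=
  csum2 (D5_term g1 a1 b1 g2 a2 b2 d1 a3 b3 d2 a4 d3 b4 x y).

(* Main.v *)
Require Import Defs.
From HB Require Import structures.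
From mathcomp Require Import all_boot all_order all_algebra.
From mathcomp Require Import all_classical all_reals all_analysis.
From mathcomp Require Import measurable_realfun complex ring lra.

Set Implicit Arguments.
Unset Strict Implicit.
Unset Printing Implicit Defensive.

Import Order.TTheory GRing.Theory Num.Theory.
Import numFieldNormedType.Exports.

Local Open Scope classical_set_scope.
Local Open Scope ring_scope.
Local Open Scope complex_scope.

(** Expand D5 under the integral sign.  For 0 < xi < 1 the term of index (m, n) of
    the integrand is a constant times xi^(z - 1) (1 - xi)^(w - 1), with
    z = gamma_2 + alpha_2 m and w = gamma_3 + beta_2 n, so its integral is
    a multiple of B(z, w).  Euler's relation
    B(z, w) Gamma (z + w) = Gamma z Gamma w replaces the factor Gamma (z + w) of
    D5 by the factors Gamma z Gamma w of D1: this is the identity, term by term.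

    The exchange of sum and integral needs the integrals of the moduli of the
    terms to be summable.  Such an integral contains B(Re z, Re w), hence is
    controlled by Gamma (Re z) Gamma (Re w), whereas the absolute convergence of
    D1 controls |Gamma z| |Gamma w|.  As m and n vary, z and w move on horizontal
    half-lines, where |Gamma z| >= c Gamma (Re z) with a constant c > 0
    ([Gamma_ge_real_Gamma]).  So the absolute convergence of D1 bounds the sum of
    these integrals, and dominated convergence applies to the square partial
    sums, which converge to the integrand for each xi ([cintegral_sqsum]).

    Everything about Gamma comes from its integral.  Euler's relation
    ([cintegral_betaK], [beta_Gamma]) is Fubini's theorem for the product of two
    Gamma integrals.  At w = 1 it gives Gamma (z + 1) = z Gamma z ([GammaS]).
    The lower bound is obtained for large Re z by recentring the phase of the
    integrand ([Gamma_lower_bound]), then for all Re z bounded away from 0 by the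
    recurrence; it also shows that Gamma has no zero with Re z > 0. *)

Local Notation Re := (@complex.Re _).
Local Notation Im := (@complex.Im _).
Local Notation normc := ComplexField.Normc.normc.

(** * Real and imaginary parts, modulus *)

Section ComplexParts.
Variable R : realType.
Implicit Types z w : R[i].

Lemma ReD z w : Re (z + w) = Re z + Re w. Proof. by case: z w => [? ?] []. Qed.
Lemma ImD z w : Im (z + w) = Im z + Im w. Proof. by case: z w => [? ?] []. Qed.
Lemma ReN z : Re (- z) = - Re z. Proof. by case: z. Qed.
Lemma ImN z : Im (- z) = - Im z. Proof. by case: z. Qed.
Lemma ReM z w : Re (z * w) = Re z * Re w - Im z * Im w.
Proof. by case: z w => [? ?] []. Qed.
Lemma ImM z w : Im (z * w) = Re z * Im w + Im z * Re w.
Proof. by case: z w => [? ?] []. Qed.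

Lemma Re_sum (I : Type) (s : seq I) (F : I -> R[i]) :
  Re (\sum_(i <- s) F i) = \sum_(i <- s) Re (F i).
Proof. exact: (big_morph _ ReD). Qed.
Lemma Im_sum (I : Type) (s : seq I) (F : I -> R[i]) :
  Im (\sum_(i <- s) F i) = \sum_(i <- s) Im (F i).
Proof. exact: (big_morph _ ImD). Qed.

Lemma complex_ext z w : Re z = Re w -> Im z = Im w -> z = w.
Proof. by case: z w => [a b] [c d] /= -> ->. Qed.

Lemma normc_ge0 z : 0 <= normc z.
Proof. by case: z => a b; exact: sqrtr_ge0. Qed.

Lemma normc_eq0 z : (normc z == 0) = (z == 0).
Proof.
apply/eqP/eqP => [/ComplexField.Normc.eq0_normc//|->].
exact: ComplexField.Normc.normc0.
Qed.

Lemma normc_gt0 z : (0 < normc z) = (z != 0).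
Proof. by rewrite lt_def normc_ge0 andbT normc_eq0. Qed.

Lemma sqr_normcE z : normc z ^+ 2 = Re z ^+ 2 + Im z ^+ 2.
Proof. by case: z => a b /=; rewrite sqr_sqrtr// addr_ge0// sqr_ge0. Qed.

Lemma normc_real (r : R) : normc r%:C = `|r|.
Proof. by rewrite /= expr0n addr0 sqrtr_sqr. Qed.

Lemma le_Re_normc z : `|Re z| <= normc z.
Proof.
rewrite -(ler_pXn2r (n := 2)) ?nnegrE ?normc_ge0//.
by rewrite real_normK ?num_real// sqr_normcE lerDl sqr_ge0.
Qed.

Lemma le_Im_normc z : `|Im z| <= normc z.
Proof.
rewrite -(ler_pXn2r (n := 2)) ?nnegrE ?normc_ge0//.
by rewrite real_normK ?num_real// sqr_normcE lerDr sqr_ge0.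
Qed.

Lemma normc_le_ReIm z : normc z <= `|Re z| + `|Im z|.
Proof.
rewrite -(ler_pXn2r (n := 2)) ?nnegrE ?normc_ge0 ?addr_ge0//.
rewrite sqr_normcE sqrrD !real_normK ?num_real//.
by rewrite -addrA lerD2l lerDr mulrn_wge0// mulr_ge0.
Qed.

End ComplexParts.

(** * Measurability and integrals of complex-valued functions *)

Section MeasurableComplex.
Context d (T : measurableType d) (R : realType).
Implicit Types (D : set T) (f g : T -> R[i]).

Definition cmeasurable D f :=
  measurable_fun D (Re \o f) /\ measurable_fun D (Im \o f).

Lemma cmeasurableM D f g :
  cmeasurable D f -> cmeasurable D g -> cmeasurable D (fun t => f t * g t).
Proof.
move=> [f1 f2] [g1 g2]; split.
  rewrite [X in measurable_fun _ X](_ : _ =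
    fun t => Re (f t) * Re (g t) - Im (f t) * Im (g t)).
    by apply: measurable_funB; apply: measurable_funM.
  by apply/funext => t /=; rewrite ReM.
rewrite [X in measurable_fun _ X](_ : _ =
  fun t => Re (f t) * Im (g t) + Im (f t) * Re (g t)).
  by apply: measurable_funD; apply: measurable_funM.
by apply/funext => t /=; rewrite ImM.
Qed.

Lemma cmeasurable_real D (f : T -> R) :
  measurable_fun D f -> cmeasurable D (fun t => (f t)%:C).
Proof. by move=> mf; split => //; exact: measurable_cst. Qed.

Lemma cmeasurable_normc D f :
  cmeasurable D f -> measurable_fun D (fun t => normc (f t)).
Proof.
move=> [f1 f2].
rewrite (_ : (fun t => _) =
  (fun r : R => r `^ 2^-1) \o (fun t => Re (f t) ^+ 2 + Im (f t) ^+ 2)).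
  apply: measurableT_comp; first exact: measurable_powR.
  by apply: measurable_funD; exact: measurable_funX.
apply/funext => t /=.
by rewrite -sqr_normcE powR12_sqrt ?sqr_ge0// sqrtr_sqr ger0_norm ?normc_ge0.
Qed.

End MeasurableComplex.

Lemma cmeasurableT_comp d d' (S : measurableType d) (T : measurableType d')
    (R : realType) (D : set S) (f : T -> R[i]) (g : S -> T) :
  cmeasurable setT f -> measurable_fun D g -> cmeasurable D (fun t => f (g t)).
Proof.
by move=> [f1 f2] mg; split; rewrite compA; exact: measurableT_comp.
Qed.

Section ComplexIntegral.
Variable R : realType.
Notation mu := (@lebesgue_measure R).
Notation RT := (measurableTypeR R).
Implicit Types (D : set RT) (f g : RT -> R[i]).

Lemma cintegrable_dom D f (g : RT -> R) : measurable D -> cmeasurable D f ->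
  mu.-integrable D (EFin \o g) -> (forall t, D t -> normc (f t) <= g t) ->
  cintegrable D f.
Proof.
move=> mD [f1 f2] ig fg; split.
  apply: le_integrable ig => //; first exact/measurable_EFinP.
  move=> t Dt /=; rewrite lee_fin (le_trans (le_Re_normc _))//.
  by rewrite (le_trans (fg _ Dt))// ler_norm.
apply: le_integrable ig => //; first exact/measurable_EFinP.
move=> t Dt /=; rewrite lee_fin (le_trans (le_Im_normc _))//.
by rewrite (le_trans (fg _ Dt))// ler_norm.
Qed.

Lemma cintegrable_measurable D f : cintegrable D f -> cmeasurable D f.
Proof.
by move=> [/measurable_int/measurable_EFinP ? /measurable_int/measurable_EFinP].
Qed.

Lemma cintegrable_normc D f : measurable D -> cintegrable D f ->
  mu.-integrable D (fun t => (normc (f t))%:E).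
Proof.
move=> mD cf; have [f1 f2] := cf.
have := integrableD mD (integrable_norm f1) (integrable_norm f2).
apply: le_integrable => //.
  by apply/measurable_EFinP/cmeasurable_normc/cintegrable_measurable.
move=> t _; rewrite /= lee_fin (ger0_norm (normc_ge0 _)) ger0_norm ?addr_ge0//.
exact: normc_le_ReIm.
Qed.

Lemma eq_cintegral D f g : {in D, f =1 g} -> cintegral D f = cintegral D g.
Proof.
by move=> fg; congr (_ +i* _); apply: eq_Rintegral => t Dt; rewrite fg.
Qed.

Lemma eq_cintegrable D f g : measurable D -> {in D, f =1 g} ->
  cintegrable D f -> cintegrable D g.
Proof.
move=> mD fg [f1 f2]; split; [move: f1|move: f2]; apply: eq_integrable => // t Dt;
  by rewrite fg.
Qed.

Lemma cintegral_mkcond D f :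
  cintegral D f = cintegral setT (fun t => if t \in D then f t else 0).
Proof.
rewrite /cintegral Rintegral_mkcond [in X in _ +i* X]Rintegral_mkcond.
by congr (_ +i* _); apply: eq_Rintegral => t _; rewrite patchE; case: ifP.
Qed.

Lemma cintegrable_mkcond D f : measurable D ->
  cintegrable D f <-> cintegrable setT (fun t => if t \in D then f t else 0).
Proof.
move=> mD; rewrite /cintegrable !(integrable_mkcond _ mD).
suff E (p : R[i] -> R) : p 0 = 0 ->
    (fun t : RT => (p (f t))%:E) \_ D =
    (fun t => (p (if t \in D then f t else 0))%:E).
  by rewrite (E Re)// (E Im).
by move=> p0; apply/funext => t; rewrite !patchE; case: ifP => //; rewrite p0.
Qed.

Lemma cintegrableD D f g : measurable D ->
  cintegrable D f -> cintegrable D g -> cintegrable D (fun t => f t + g t).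
Proof.
move=> mD [f1 f2] [g1 g2]; split.
  have := integrableD mD f1 g1; apply: eq_integrable => // t _ /=.
  by rewrite ReD.
have := integrableD mD f2 g2; apply: eq_integrable => // t _ /=.
by rewrite ImD.
Qed.

Lemma cintegralD D f g : measurable D -> cintegrable D f -> cintegrable D g ->
  cintegral D (fun t => f t + g t) = cintegral D f + cintegral D g.
Proof.
move=> mD [f1 f2] [g1 g2]; apply: complex_ext; rewrite ?(ReD, ImD) /=.
  by rewrite -RintegralD//; apply: eq_Rintegral => t _; rewrite ReD.
by rewrite -RintegralD//; apply: eq_Rintegral => t _; rewrite ImD.
Qed.

Lemma cintegrableZ D f (c : R[i]) : measurable D -> cintegrable D f ->
  cintegrable D (fun t => c * f t).
Proof.
move=> mD [f1 f2]; split.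
  have := integrableB mD (integrableZl mD (Re c) f1) (integrableZl mD (Im c) f2).
  by apply: eq_integrable => // t _ /=; rewrite ReM.
have := integrableD mD (integrableZl mD (Re c) f2) (integrableZl mD (Im c) f1).
by apply: eq_integrable => // t _ /=; rewrite ImM.
Qed.

Lemma cintegralZ D f (c : R[i]) : measurable D -> cintegrable D f ->
  cintegral D (fun t => c * f t) = c * cintegral D f.
Proof.
move=> mD [f1 f2]; apply: complex_ext.
  rewrite ReM /= -!RintegralZl// -RintegralB//; first last.
  - exact: (integrableZl mD _ f2).
  - exact: (integrableZl mD _ f1).
  by apply: eq_Rintegral => t _; rewrite ReM.
rewrite ImM /= -!RintegralZl// -RintegralD//; first last.
- exact: (integrableZl mD _ f1).
- exact: (integrableZl mD _ f2).
by apply: eq_Rintegral => t _; rewrite ImM.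
Qed.

Lemma cintegrable_cintegral_sum D (I : Type) (s : seq I) (F : I -> RT -> R[i]) :
  measurable D -> (forall i, cintegrable D (F i)) ->
  cintegrable D (fun t => \sum_(i <- s) F i t) /\
  cintegral D (fun t => \sum_(i <- s) F i t) = \sum_(i <- s) cintegral D (F i).
Proof.
move=> mD iF; elim: s => [|i s [IH1 IH2]].
  have -> : (fun t : RT => \sum_(i <- [::]) F i t) = (fun t => 0 * (fun=> 0) t).
    by apply/funext => t; rewrite big_nil mul0r.
  have i0 : cintegrable D (fun=> 0) by split; exact: integrable0.
  by split; [exact: cintegrableZ|rewrite cintegralZ// mul0r big_nil].
have -> : (fun t => \sum_(j <- i :: s) F j t) =
    fun t => F i t + \sum_(j <- s) F j t.
  by apply/funext => t; rewrite big_cons.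
by split; [exact: cintegrableD|rewrite cintegralD// IH2 big_cons].
Qed.

End ComplexIntegral.

(** Multiplying by the conjugate of the integral makes it real and nonnegative;
    then the real part of the integrand is bounded by its modulus. *)
Lemma le_normc_cintegral (R : realType) (D : set (measurableTypeR R))
    (f : measurableTypeR R -> R[i]) : measurable D -> cintegrable D f ->
  normc (cintegral D f) <= \int[@lebesgue_measure R]_(t in D) normc (f t).
Proof.
move=> mD cf; set I := cintegral D f.
have [->|I0] := eqVneq I 0.
  by rewrite ComplexField.Normc.normc0; apply: Rintegral_ge0 => t _; exact: normc_ge0.
have nI : 0 < normc I by rewrite normc_gt0.
have nf := cintegrable_normc mD cf.
rewrite -(ler_pM2l nI) -expr2 -RintegralZl//.
have -> : normc I ^+ 2 = Re ((I^*)%C * I).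
  by rewrite sqr_normcE ReM /=; case: (I) => a b /=; ring.
have cf' := cintegrableZ (I^*)%C mD cf.
rewrite -(cintegralZ (I^*)%C mD cf) /=; apply: le_Rintegral => //.
- by case: cf'.
- exact: (integrableZl mD _ nf).
- move=> t _; apply: le_trans (ler_norm _) _; apply: le_trans (le_Re_normc _) _.
  rewrite ComplexField.Normc.normcM (_ : normc (I^*)%C = normc I)//.
  by case: (I) => a b /=; rewrite sqrrN.
Qed.

(** * Affine substitution and Fubini's theorem *)

Section AffineSubstitution.
Variable R : realType.
Notation RT := (measurableTypeR R).
Notation mu := (@lebesgue_measure R).
Variables (a b : R).
Hypothesis a0 : a != 0.

Let phi (s : RT) : RT := a * s + b.

Lemma measurable_affine : measurable_fun setT phi.
Proof.
by apply: measurable_funD => //; apply: measurable_funM.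
Qed.

(** The measure A |-> |a| mu {s | a s + b \in A}: it agrees with Lebesgue measure
    on half-open intervals, hence everywhere. *)
Let nu : {measure set RT -> \bar R}.
Proof.
refine (mscale (NngNum (normr_ge0 a)) (pushforward mu phi)).
exact: measurable_affine.
Defined.

Lemma lebesgue_measure_affine (A : set RT) : measurable A ->
  mu A = (`|a|%:E * mu (phi @^-1` A))%E.
Proof.
move=> mA; have mphi := measurable_affine.
rewrite -[RHS]/(nu A).
apply: (@lebesgue_measure_unique R nu) mA => _ [[p q]] _ <-.
have -> : nu [set` `]p, q]] = (`|a|%:E * mu (phi @^-1` [set` `]p, q]]))%E.
  by [].
have E s : (p < phi s <= q) = if 0 < a then (p - b) / a < s <= (q - b) / a
    else (q - b) / a <= s < (p - b) / a.
  case: ifPn => [a_gt0|].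
    by rewrite ltr_pdivrMr// ler_pdivlMr// ltrBlDr lerBrDr /phi [s * _]mulrC.
  rewrite -leNgt le_eqVlt (negbTE a0) orFb => an0.
  by rewrite ler_ndivrMr// ltr_ndivlMr// lerBrDr ltrBlDr /phi [s * _]mulrC andbC.
have P : phi @^-1` [set` `]p, q]] = if 0 < a then `](p - b) / a, (q - b) / a]%classic
    else `[(q - b) / a, (p - b) / a[%classic.
  apply/seteqP; split => s /=.
    by rewrite in_itv /= E; case: ifP; rewrite /= in_itv.
  by rewrite in_itv /= E; case: ifP; rewrite /= in_itv.
rewrite [X in (_ * mu X)%E]P (fun_if mu) !lebesgue_measure_itv /= !lte_fin.
case: (boolP (0 < a)) => [a_gt0|].
  rewrite ltr_pM2r ?invr_gt0// ltrD2r.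
  case: ifP => _; last by rewrite mule0.
  rewrite -!EFinD -EFinM gtr0_norm//; congr EFin.
  by rewrite -mulrBl mulrCA divff// mulr1 opprB addrA addrNK.
rewrite -leNgt le_eqVlt (negbTE a0) orFb => an0.
rewrite ltr_nM2r ?invr_lt0// ltrD2r.
case: ifP => _; last by rewrite mule0.
rewrite -!EFinD -EFinM ltr0_norm//; congr EFin.
rewrite -mulrBl mulNr mulrCA divff// mulr1; ring.
Qed.

Lemma ge0_integral_affine (h : RT -> \bar R) : measurable_fun setT h ->
  (forall s, 0 <= h s)%E ->
  (\int[mu]_s h s = `|a|%:E * \int[mu]_s h (a * s + b)%R)%E.
Proof.
move=> mh h0; have mphi := measurable_affine.
rewrite (eq_measure_integral nu); last first.
  by move=> A mA _; exact: lebesgue_measure_affine.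
by rewrite ge0_integral_mscale// ge0_integral_pushforward.
Qed.

Lemma integrable_affine (h : RT -> R) :
  mu.-integrable setT (EFin \o h) ->
  mu.-integrable setT (fun s => (h (a * s + b))%:E).
Proof.
move=> /integrableP[/measurable_EFinP mh ih]; apply/integrableP; split.
  by apply/measurable_EFinP; apply: measurableT_comp mh measurable_affine.
have an0 : 0 < `|a| by rewrite normr_gt0.
rewrite ge0_integral_affine// in ih; last first.
  by apply: measurableT_comp => //; exact/measurable_EFinP.
rewrite -(@lte_pmul2l _ `|a|%:E)//; first by rewrite gt0_muley.
Qed.

(** The nonnegative case, applied to the positive and negative parts of h. *)
Lemma Rintegral_affine (h : RT -> R) :
  mu.-integrable setT (EFin \o h) ->
  \int[mu]_s h s = `|a| * \int[mu]_s h (a * s + b).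
Proof.
move=> ih; have ih' := integrable_affine ih.
have /measurable_EFinP mh := measurable_int _ ih.
rewrite /Rintegral -[`|a|]/(fine `|a|%:E) -fineM//; last exact: integrable_fin_num.
congr fine.
have me : measurable_fun setT (EFin \o h) by exact/measurable_EFinP.
rewrite integralE ge0_integral_affine//; last exact: measurable_funepos.
rewrite [X in (_ - X)%E]ge0_integral_affine//; last exact: measurable_funeneg.
rewrite -muleBr//; last first.
  apply: fin_num_adde_defl; rewrite fin_numN.
  have := integrable_neg_fin_num measurableT ih'.
  by rewrite (funeneg_comp (EFin \o h) phi).
rewrite [in RHS]integralE; congr (_ * (_ - _))%E.
  by rewrite (funepos_comp (EFin \o h) phi).
by rewrite (funeneg_comp (EFin \o h) phi).
Qed.

End AffineSubstitution.

Section ComplexAffine.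
Variable R : realType.
Notation RT := (measurableTypeR R).
Notation mu := (@lebesgue_measure R).
Implicit Types f : RT -> R[i].

Lemma cintegrable_affine (a b : R) f : a != 0 -> cintegrable setT f ->
  cintegrable setT (fun s => f (a * s + b)).
Proof.
move=> a0 [f1 f2]; split.
  exact: (integrable_affine b a0 f1).
exact: (integrable_affine b a0 f2).
Qed.

Lemma cintegral_affine (a b : R) f : a != 0 -> cintegrable setT f ->
  cintegral setT f = `|a|%:C * cintegral setT (fun s => f (a * s + b)).
Proof.
move=> a0 [f1 f2]; apply: complex_ext.
  by rewrite ReM /= mul0r subr0; exact: (Rintegral_affine b a0 f1).
by rewrite ImM /= mul0r addr0; exact: (Rintegral_affine b a0 f2).
Qed.

End ComplexAffine.

Section ComplexFubini.
Variable R : realType.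
Notation RT := (measurableTypeR R).
Notation mu := (@lebesgue_measure R).

(** Sections are required to be integrable at every point, not only almost
    everywhere: an inner [cintegral] is the finite part of an extended real
    integral, and equals it only where that integral is finite. *)
Lemma cintegral_Fubini (F : RT * RT -> R[i]) : cmeasurable setT F ->
  (\int[mu]_s \int[mu]_u (normc (F (s, u)))%:E < +oo)%E ->
  (forall s, cintegrable setT (fun u => F (s, u))) ->
  (forall u, cintegrable setT (fun s => F (s, u))) ->
  cintegral setT (fun s => cintegral setT (fun u => F (s, u))) =
  cintegral setT (fun u => cintegral setT (fun s => F (s, u))).
Proof.
move=> mF iF i1 i2; have [F1 F2] := mF.
have mnF := cmeasurable_normc mF.
have key (p : R[i] -> R) : measurable_fun setT (p \o F) ->
    (forall z, `|p z| <= normc z) ->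
    (forall s, mu.-integrable setT (fun u => (p (F (s, u)))%:E)) ->
    (forall u, mu.-integrable setT (fun s => (p (F (s, u)))%:E)) ->
    \int[mu]_s (\int[mu]_u p (F (s, u))) = \int[mu]_u (\int[mu]_s p (F (s, u))).
  move=> mp np ip1 ip2.
  have mpE : measurable_fun setT (EFin \o (p \o F)) by exact/measurable_EFinP.
  have ip : (mu \x mu)%E.-integrable setT (EFin \o (p \o F)).
    apply/integrable12ltyP => //; apply: le_lt_trans iF.
    have mab : measurable_fun setT (fun su : RT * RT => `|(EFin \o (p \o F)) su|)%E.
      exact: measurableT_comp.
    have mn : measurable_fun setT (fun su : RT * RT => (normc (F su))%:E).
      exact/measurable_EFinP.
    apply: ge0_le_integral => //.
    - by move=> s _; exact: integral_ge0.
    - exact: (measurable_fun_fubini_tonelli_F _ mab).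
    - apply: (measurable_fun_fubini_tonelli_F _ mn) => su.
      by rewrite lee_fin normc_ge0.
    - move=> s _; apply: ge0_le_integral => //.
      + exact: (measurableT_comp mab (pair1_measurable s)).
      + exact: (measurableT_comp mn (pair1_measurable s)).
      + by move=> u _; rewrite lee_fin np.
  rewrite /Rintegral; congr fine.
  have E1 : (fun s => (fine (\int[mu]_u (p (F (s, u)))%:E))%:E) =
      (fun s => \int[mu]_u (p (F (s, u)))%:E)%E.
    by apply/funext => s; rewrite fineK//; exact: integrable_fin_num.
  have E2 : (fun u => (fine (\int[mu]_s (p (F (s, u)))%:E))%:E) =
      (fun u => \int[mu]_s (p (F (s, u)))%:E)%E.
    by apply/funext => u; rewrite fineK//; exact: integrable_fin_num.
  by rewrite E1 E2; exact: (Fubini ip).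
apply: complex_ext.
- apply: key => //; [exact: le_Re_normc|by move=> s; case: (i1 s)|].
  by move=> u; case: (i2 u).
- apply: key => //; [exact: le_Im_normc|by move=> s; case: (i1 s)|].
  by move=> u; case: (i2 u).
Qed.

End ComplexFubini.

(** * Complex powers of a positive real *)

Section ComplexPower.
Variable R : realType.
Implicit Types (s t : R) (z w : R[i]).

Lemma normc_cpow t z : normc (cpow t z) = t `^ Re z.
Proof.
rewrite ComplexField.Normc.normcM normc_real ger0_norm ?powR_ge0//=.
by rewrite cos2Dsin2 sqrtr1 mulr1.
Qed.

Lemma cpow_real t (r : R) : cpow t r%:C = (t `^ r)%:C.
Proof. by rewrite /cpow /= mul0r cos0 sin0 mulr1. Qed.

Lemma cpow_nat t n : 0 < t -> cpow t n%:R = (t ^+ n)%:C.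
Proof.
move=> t0; rewrite -powR_mulrn ?ltW// -cpow_real; congr (cpow t).
by rewrite rmorph_nat.
Qed.

Lemma cpowD t z w : 0 < t -> cpow t (z + w) = cpow t z * cpow t w.
Proof.
move=> t0; rewrite /cpow ReD ImD powRD; last by rewrite (gt_eqF t0) implybT.
rewrite mulrDl cosD sinD; apply: complex_ext => /=; ring.
Qed.

Lemma cpowM s t z : 0 < s -> 0 < t -> cpow (s * t) z = cpow s z * cpow t z.
Proof.
move=> s0 t0; rewrite /cpow powRM ?ltW// lnM// mulrDr cosD sinD.
apply: complex_ext => /=; ring.
Qed.

Lemma cmeasurable_cpow z : cmeasurable setT (fun t : R => cpow t z).
Proof.
apply: cmeasurableM; first by apply: cmeasurable_real; exact: measurable_powR.
have mln : measurable_fun setT (fun t : R => Im z * ln t).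
  by apply: measurable_funM => //; exact: measurable_ln.
split.
  apply: (measurableT_comp _ mln); apply: continuous_measurable_fun.
  exact: continuous_cos.
apply: (measurableT_comp _ mln); apply: continuous_measurable_fun.
exact: continuous_sin.
Qed.

End ComplexPower.

(** ** The fundamental theorem of calculus for t^z on [a, 1] *)

Section PowerPrimitive.
Variable R : realType.
Notation mu := (@lebesgue_measure R).
Variables p q : R.

Let is_derive_Mln k (t : R) : 0 < t ->
  is_derive t 1 (fun s : R => k * ln s) (k / t).
Proof.
move=> t0; have dln := is_derive1_ln t0.
exact: (is_deriveZ k dln).
Qed.

(** The real part of t^(p + iq).  It is written with [expR] and [ln] rather than
    with [cpow], whose value for t <= 0 is set apart, so that the chain rule
    applies directly. *)
Lemma is_derive_Re_pow (t : R) : 0 < t ->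
  is_derive t 1 (fun s : R => expR (p * ln s) * cos (q * ln s))
    (expR (p * ln t) * (p * cos (q * ln t) - q * sin (q * ln t)) / t).
Proof.
move=> t0.
have d1 : is_derive t 1 (fun s : R => expR (p * ln s)) (expR (p * ln t) * (p / t)).
  exact: (is_derive1_comp (is_derive_expR _) (is_derive_Mln p t0)).
have d2 : is_derive t 1 (fun s : R => cos (q * ln s)) (- sin (q * ln t) * (q / t)).
  exact: (is_derive1_comp (is_derive_cos _) (is_derive_Mln q t0)).
apply: (is_derive_eq (is_deriveM d1 d2)).
by rewrite /GRing.scale /=; ring.
Qed.

Lemma is_derive_Im_pow (t : R) : 0 < t ->
  is_derive t 1 (fun s : R => expR (p * ln s) * sin (q * ln s))
    (expR (p * ln t) * (p * sin (q * ln t) + q * cos (q * ln t)) / t).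
Proof.
move=> t0.
have d1 : is_derive t 1 (fun s : R => expR (p * ln s)) (expR (p * ln t) * (p / t)).
  exact: (is_derive1_comp (is_derive_expR _) (is_derive_Mln p t0)).
have d2 : is_derive t 1 (fun s : R => sin (q * ln s)) (cos (q * ln t) * (q / t)).
  exact: (is_derive1_comp (is_derive_sin _) (is_derive_Mln q t0)).
apply: (is_derive_eq (is_deriveM d1 d2)).
by rewrite /GRing.scale /=; ring.
Qed.

Let continuous_pow (t u v : R) : 0 < t ->
  {for t, continuous (fun s : R =>
    expR (p * ln s) * (u * cos (q * ln s) + v * sin (q * ln s)) / s)}.
Proof.
move=> t0.
have cl k : {for t, continuous (fun s : R => k * ln s)}.
  by apply: continuousM; [exact: cst_continuous|exact: continuous_ln].
have ce : {for t, continuous (fun s : R => expR (p * ln s))}.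
  exact: (continuous_comp (cl p) (@continuous_expR _ _)).
have cc : {for t, continuous (fun s : R => cos (q * ln s))}.
  exact: (continuous_comp (cl q) (@continuous_cos _ _)).
have cs : {for t, continuous (fun s : R => sin (q * ln s))}.
  exact: (continuous_comp (cl q) (@continuous_sin _ _)).
apply: continuousM.
  apply: continuousM => //.
  by apply: continuousD; apply: continuousM => //; exact: cst_continuous.
by apply: continuousV => //; exact: lt0r_neq0.
Qed.

Let FTC (a u v : R) (F : R -> R) : 0 < a < 1 ->
  (forall t : R, 0 < t -> is_derive t 1 F
    (expR (p * ln t) * (u * cos (q * ln t) + v * sin (q * ln t)) / t)) ->
  (\int[mu]_(t in `[a, 1%R])
    (expR (p * ln t) * (u * cos (q * ln t) + v * sin (q * ln t)) / t)%:E =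
   (F 1)%:E - (F a)%:E)%E.
Proof.
move=> /andP[a0 a1] dF.
have cF (t : R) : 0 < t -> {for t, continuous F}.
  move=> t0; have [dFt _] := dF _ t0.
  exact/differentiable_continuous/derivable1_diffP.
apply: continuous_FTC2 => //.
- apply: continuous_in_subspaceT => t; rewrite inE/= in_itv/= => /andP[at_ _].
  by apply: continuous_pow; exact: lt_le_trans at_.
- split.
  + move=> t; rewrite in_itv/= => /andP[at_ _].
    by have [] := dF _ (lt_trans a0 at_).
  + by apply: cvg_at_right_filter; exact: cF.
  + by apply: cvg_at_left_filter; exact: cF.
- move=> t; rewrite in_itv/= => /andP[at_ _].
  by rewrite derive1E; have [] := dF _ (lt_trans a0 at_).
Qed.

Lemma integral_Re_pow a : 0 < a < 1 ->
  (\int[mu]_(t in `[a, 1%R])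
    (expR (p * ln t) * (p * cos (q * ln t) - q * sin (q * ln t)) / t)%:E =
   (1 - expR (p * ln a) * cos (q * ln a))%:E)%E.
Proof.
move=> a01.
under eq_integral do rewrite -mulNr.
have dF (t : R) : 0 < t -> is_derive t 1
    (fun s : R => expR (p * ln s) * cos (q * ln s))
    (expR (p * ln t) * (p * cos (q * ln t) + - q * sin (q * ln t)) / t).
  by move=> t0; rewrite mulNr; exact: is_derive_Re_pow.
by rewrite (FTC a01 dF) ln1 !mulr0 expR0 cos0 mulr1.
Qed.

Lemma integral_Im_pow a : 0 < a < 1 ->
  (\int[mu]_(t in `[a, 1%R])
    (expR (p * ln t) * (p * sin (q * ln t) + q * cos (q * ln t)) / t)%:E =
   (- (expR (p * ln a) * sin (q * ln a)))%:E)%E.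
Proof.
move=> a01.
under eq_integral do rewrite addrC.
have dF (t : R) : 0 < t -> is_derive t 1
    (fun s : R => expR (p * ln s) * sin (q * ln s))
    (expR (p * ln t) * (q * cos (q * ln t) + p * sin (q * ln t)) / t).
  by move=> t0; rewrite addrC; exact: is_derive_Im_pow.
by rewrite (FTC a01 dF) ln1 !mulr0 sin0 mulr0 -EFinB sub0r.
Qed.

End PowerPrimitive.

(** * The power kernel on the half-line *)

Section PowerKernel.
Variable R : realType.
Notation RT := (measurableTypeR R).
Notation mu := (@lebesgue_measure R).
Implicit Types (s t : R) (z w : R[i]).

(** The kernel s^(z - 1) of Euler's integrals, truncated to s > 0.  As a function
    on the whole line it can be translated, reflected and rescaled with no
    change of domain of integration. *)
Definition tpow z s : R[i] := if 0 < s then cpow s (z - 1) else 0.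

(** The modulus of [tpow]: see [normc_tpow]. *)
Definition tpowR (r : R) s : R := if 0 < s then s `^ (r - 1) else 0.

Lemma tpowR_ge0 r s : 0 <= tpowR r s.
Proof. by rewrite /tpowR; case: ifP => // _; exact: powR_ge0. Qed.

Lemma normc_tpow z s : normc (tpow z s) = tpowR (Re z) s.
Proof.
rewrite /tpow /tpowR; case: ifP => _; last exact: ComplexField.Normc.normc0.
by rewrite normc_cpow ReD.
Qed.

Lemma tpow_real (r : R) s : tpow r%:C s = (tpowR r s)%:C.
Proof.
by rewrite /tpow /tpowR; case: ifP => // _; rewrite -cpow_real rmorphB.
Qed.

Lemma cmeasurable_tpow z : cmeasurable setT (tpow z : RT -> R[i]).
Proof.
rewrite (_ : tpow z =
    fun s => (\1_(`]0, +oo[%classic : set RT) s)%:C * cpow s (z - 1)).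
  apply: cmeasurableM; last exact: cmeasurable_cpow.
  by apply: cmeasurable_real; exact: measurable_indic.
apply/funext => s; rewrite /tpow indicE.
have [s0|s0] := ltP 0 s; first by rewrite mem_set ?mul1r//= in_itv/= s0.
by rewrite memNset ?mul0r//= in_itv/= andbT; apply/negP; rewrite -leNgt.
Qed.

Lemma measurable_tpowR r : measurable_fun setT (tpowR r : RT -> R).
Proof.
rewrite (_ : tpowR r = fun s => normc (tpow r%:C s)).
  by apply: cmeasurable_normc; exact: cmeasurable_tpow.
by apply/funext => s; rewrite normc_tpow.
Qed.

Lemma tpowM z s t : 0 < s -> tpow z (s * t) = cpow s (z - 1) * tpow z t.
Proof.
move=> s0; rewrite /tpow pmulr_rgt0//; case: ifP => t0; last by rewrite mulr0.
by rewrite cpowM.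
Qed.

Lemma tpowRM (r : R) s t : 0 < s -> tpowR r (s * t) = s `^ (r - 1) * tpowR r t.
Proof.
move=> s0; rewrite /tpowR pmulr_rgt0//; case: ifP => t0; last by rewrite mulr0.
by rewrite powRM// ltW.
Qed.

Lemma tpowE z s : 0 < s -> tpow z s = cpow s z * s^-1%:C.
Proof.
move=> s0; rewrite /tpow s0 cpowD//; congr (_ * _).
rewrite (_ : - 1 = (- 1)%:C); last by rewrite rmorphN.
by rewrite cpow_real powR_inv1// ltW.
Qed.

Lemma powRexp (r s : R) : 0 < s -> s `^ r = expR (r * ln s).
Proof. by move=> s0; rewrite /powR gt_eqF. Qed.

Lemma tpowR_exp (r s : R) : 0 < s -> tpowR r s = expR (r * ln s) / s.
Proof.
move=> s0; rewrite /tpowR s0 powRB ?(gt_eqF s0) ?implybT//.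
by rewrite powRr1 ?ltW// powRexp.
Qed.

(** Monotone convergence along the intervals [1/(n + 2), 1], on each of which the
    primitive s^r / r bounds the integral by 1/r. *)
Lemma integrable_tpowR01 (r : R) : 0 < r ->
  mu.-integrable `]0%R, 1%R]%classic (EFin \o tpowR r).
Proof.
move=> r0; apply/integrableP; split.
  by apply/measurable_EFinP; apply: measurable_funTS; exact: measurable_tpowR.
under eq_integral do rewrite /= ger0_norm ?tpowR_ge0//.
pose D : set RT := `]0%R, 1%R]%classic.
pose E n : set RT := `[n.+2%:R^-1, 1%R]%classic.
pose g n : RT -> \bar R := (fun s => (tpowR r s)%:E) \_ (E n).
have mE n : measurable (E n) by exact: measurable_itv.
have g0 n s : (0 <= g n s)%E.
  by rewrite /g patchE; case: ifP => // _; rewrite lee_fin tpowR_ge0.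
have gE n : (\int[mu]_(s in D) g n s <= (r^-1)%:E)%E.
  rewrite /g -integral_mkcondr setIidr; last first.
    move=> s; rewrite /E /D /= !in_itv/= => /andP[ns ->]; rewrite andbT.
    by apply: lt_le_trans ns; rewrite invr_gt0.
  have an : 0 < (n.+2%:R^-1 : R) < 1.
    by rewrite invr_gt0 ltr0n/= invf_lt1// ltr1n.
  have H : (r%:E * (\int[mu]_(s in E n) (tpowR r s)%:E) =
      (1 - expR (r * ln n.+2%:R^-1))%:E)%E.
    rewrite -ge0_integralZl_EFin//; last 3 first.
    - by move=> s _; rewrite lee_fin tpowR_ge0.
    - by apply/measurable_EFinP; apply: measurable_funTS; exact: measurable_tpowR.
    - exact: ltW.
    have := integral_Re_pow r 0 an; rewrite mul0r cos0 mulr1 => <-.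
    apply: eq_integral => s; rewrite inE /E/= in_itv/= => /andP[ns _].
    rewrite tpowR_exp; last by apply: lt_le_trans ns; rewrite invr_gt0.
    by rewrite !mul0r cos0 mulr1 subr0 -EFinM mulrCA mulrA.
  rewrite -(@lee_pmul2l _ r%:E)// H -EFinM mulfV ?gt_eqF// lee_fin.
  by rewrite lerBlDr lerDl expR_ge0.
have lg s : D s -> (tpowR r s)%:E = limn (g ^~ s).
  rewrite /D /= in_itv/= => /andP[s0 s1]; apply/esym/lim_near_cst => //.
  near=> n; rewrite /g patchE mem_set//= /E /= in_itv/= s1 andbT.
  rewrite invf_ple ?posrE//; apply: ltW; near: n.
  exists (Num.truncn s^-1) => // n /= ns.
  apply: (lt_le_trans (@truncnS_gt _ s^-1 )).
  by rewrite ler_nat ltnS leqW.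
rewrite (eq_integral (fun s : RT => limn (g ^~ s))); last first.
  by move=> s; rewrite inE => Ds; exact: lg.
have mg n : measurable_fun D (g n).
  apply: measurable_funTS; apply/(measurable_restrictT _ (mE n)).
  by apply/measurable_EFinP; apply: measurable_funTS; exact: measurable_tpowR.
have nd s m n : (m <= n)%N -> (g m s <= g n s)%E.
  move=> mn; rewrite /g !patchE; case: ifPn => [|_]; last exact: g0.
  rewrite inE /E/= in_itv/= => /andP[ms s1]; rewrite mem_set//= in_itv/= s1 andbT.
  by apply: le_trans ms; rewrite lef_pV2 ?posrE// ler_nat !ltnS.
rewrite monotone_convergence//; last by move=> s _ m n; exact: nd.
apply: (@le_lt_trans _ _ (r^-1)%:E); last exact: ltry.
apply: lime_le; last exact: nearW.
apply: ereal_nondecreasing_is_cvgn => m n mn; apply: ge0_le_integral => //.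
by move=> s _; exact: nd.
Unshelve. all: by end_near. Qed.

Lemma cintegrable_tpow01 z (D : set RT) : 0 < Re z -> measurable D ->
  D `<=` `]0%R, 1%R]%classic -> cintegrable D (tpow z).
Proof.
move=> z0 mD D01; apply: (cintegrable_dom (g := tpowR (Re z))) => //.
- by have [m1 m2] := cmeasurable_tpow z; split; exact: measurable_funTS.
- apply: integrableS (integrable_tpowR01 z0) => //; exact: measurable_itv.
- by move=> s _; rewrite normc_tpow.
Qed.

(** z s^(z - 1) is the derivative of s^z. *)
Lemma cintegral_tpow_half z : 0 < Re z ->
  z * cintegral `[2^-1%R, 1%R]%classic (tpow z) = 1 - cpow 2^-1 z.
Proof.
move=> z0.
have h0 : 0 < (2^-1 : R) by rewrite invr_gt0.
have h1 : 0 < (2^-1 : R) < 1 by rewrite h0 invf_lt1// ltr1n.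
have mD : measurable (`[2^-1%R, 1%R]%classic : set RT) by exact: measurable_itv.
rewrite -cintegralZ//; last first.
  apply: cintegrable_tpow01 => // s /=; rewrite !in_itv/= => /andP[hs ->].
  by rewrite (lt_le_trans h0 hs).
have tpowE' t : t \in (`[2^-1%R, 1%R]%classic : set RT) -> z * tpow z t =
   (expR (Re z * ln t) * (Re z * cos (Im z * ln t) - Im z * sin (Im z * ln t)) / t) +i*
   (expR (Re z * ln t) * (Re z * sin (Im z * ln t) + Im z * cos (Im z * ln t)) / t).
  rewrite inE/= in_itv/= => /andP[ht _]; have t0 := lt_le_trans h0 ht.
  rewrite tpowE// /cpow powRexp//; apply: complex_ext; rewrite ?(ReM, ImM)/=; ring.
apply: complex_ext.
  rewrite [LHS]/= /Rintegral.
  rewrite (eq_integral (fun t : RT => (expR (Re z * ln t) *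
    (Re z * cos (Im z * ln t) - Im z * sin (Im z * ln t)) / t)%:E)); last first.
    by move=> t tD; rewrite tpowE'.
  by rewrite integral_Re_pow// ReD ReN /cpow powRexp//=; ring.
rewrite [LHS]/= /Rintegral.
rewrite (eq_integral (fun t : RT => (expR (Re z * ln t) *
  (Re z * sin (Im z * ln t) + Im z * cos (Im z * ln t)) / t)%:E)); last first.
  by move=> t tD; rewrite tpowE'.
by rewrite integral_Im_pow// ImD ImN /cpow powRexp//=; ring.
Qed.

(** Let I be the integral.  The substitution s -> s/2 maps ]0, 1[ onto ]0, 1/2[
    and gives I = 2^(-z) I + (1 - 2^(-z)) / z, where 2^(-z) is not 1 because its
    modulus is 2^(-Re z) < 1.  No limit at 0 is taken. *)
Lemma cintegral_tpow01 z : 0 < Re z ->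
  cintegral `]0%R, 1%R[%classic (tpow z) = z^-1.
Proof.
move=> z0.
have h0 : 0 < (2^-1 : R) by rewrite invr_gt0.
have h1 : (2^-1 : R) < 1 by rewrite invf_lt1// ltr1n.
set I := cintegral _ _.
have m01 : measurable (`]0%R, 1%R[%classic : set RT) by exact: measurable_itv.
have m0h : measurable (`]0%R, 2^-1%R[%classic : set RT) by exact: measurable_itv.
have mh1 : measurable (`[2^-1%R, 1%R[%classic : set RT) by exact: measurable_itv.
have i01 : cintegrable `]0%R, 1%R[%classic (tpow z).
  by apply: cintegrable_tpow01 => // s /=; rewrite !in_itv/= => /andP[-> /ltW].
have i0h : cintegrable `]0%R, 2^-1%R[%classic (tpow z).
  apply: cintegrable_tpow01 => // s /=; rewrite !in_itv/= => /andP[-> s1].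
  by rewrite ltW// (lt_trans s1).
have ih1 : cintegrable `[2^-1%R, 1%R[%classic (tpow z).
  apply: cintegrable_tpow01 => // s /=; rewrite !in_itv/= => /andP[hs /ltW ->].
  by rewrite (lt_le_trans h0 hs).
have E : I = cintegral `]0%R, 2^-1%R[%classic (tpow z) +
             cintegral `[2^-1%R, 1%R[%classic (tpow z).
  rewrite /I !(cintegral_mkcond `]0%R, _[%classic).
  rewrite (cintegral_mkcond `[2^-1%R, _[%classic) -cintegralD//.
  - apply: eq_cintegral => s _; rewrite !mem_setE !in_itv/=.
    have [sh|sh] := ltP s 2^-1; rewrite ?(andbT, andbF, andFb, andTb) ?addr0.
      by rewrite (lt_trans sh h1) andbT.
    by rewrite (lt_le_trans h0 sh)/= add0r.
  - exact: (cintegrable_mkcond _ m0h).1.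
  - exact: (cintegrable_mkcond _ mh1).1.
have E1 : cintegral `[2^-1%R, 1%R[%classic (tpow z) =
          cintegral `[2^-1%R, 1%R]%classic (tpow z).
  by case: ih1 => i1 i2; apply: complex_ext; apply: Rintegral_itv_bndo_bndc.
have E2 : cintegral `]0%R, 2^-1%R[%classic (tpow z) = cpow 2^-1 z * I.
  rewrite (cintegral_mkcond `]0%R, 2^-1%R[%classic).
  rewrite (cintegral_affine 0 (lt0r_neq0 h0))//; last first.
    exact: (cintegrable_mkcond _ m0h).1.
  rewrite /I (cintegral_mkcond `]0%R, 1%R[%classic).
  rewrite -2?cintegralZ//.
  - apply: eq_cintegral => s _; rewrite addr0 !mem_setE !in_itv/=.
    rewrite pmulr_rgt0// -ltr_pdivlMl// mulVf ?gt_eqF// gtr0_norm//.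
    case: ifP => _; last by rewrite !mulr0.
    rewrite tpowM// mulrA; congr (_ * _).
    rewrite mulrC -[X in _ = cpow _ X](subrK 1) [RHS]cpowD//; congr (_ * _).
    exact: (esym (cpow_nat 1 h0)).
  - exact: (cintegrable_mkcond _ m01).1.
  - have := cintegrable_affine 0 (lt0r_neq0 h0) ((cintegrable_mkcond _ m0h).1 i0h).
    done.
have zn0 : z != 0 by apply: contraTneq z0 => ->; rewrite ltxx.
have c1 : 1 - cpow 2^-1 z != 0.
  rewrite subr_eq0; apply/eqP => /(congr1 (@ComplexField.Normc.normc R)).
  rewrite ComplexField.Normc.normc1 normc_cpow => /esym/eqP.
  rewrite powR_eq1 (gt_eqF z0) orbF (lt_eqF h1)/= => h0'.
  by have := lt_trans h0 h0'; rewrite ltxx.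
have H := cintegral_tpow_half z0.
have E3 : (1 - cpow 2^-1 z) * I = cintegral `[2^-1%R, 1%R]%classic (tpow z).
  by rewrite mulrBl mul1r {1}E E2 E1 addrC addKr.
apply: (mulfI c1); rewrite E3.
by rewrite -[LHS](mulKf zn0) H mulrC.
Qed.

(** The integrand is at most s^(r - 1) on ]0, 1], and at most
    (2 r)^r e^(-s/2) for s > 1, because ln x <= x at x = s / (2 r). *)
Lemma integrable_tpowR_exp (r : R) : 0 < r ->
  mu.-integrable setT (fun s : RT => (tpowR r s * expR (- s))%:E).
Proof.
move=> r0.
pose C := 2 * expR (r * ln (2 * r)).
have mD : measurable (`]0%R, 1%R]%classic : set RT) by exact: measurable_itv.
have i1 := (integrable_mkcond _ mD).1 (integrable_tpowR01 r0).
have half0 : 0 < (2^-1 : R) by rewrite invr_gt0.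
have i2 := integrableZl measurableT C (integrable_exponential_pdf half0).
have := integrableD measurableT i1 i2.
apply: le_integrable => //.
  apply/measurable_EFinP; apply: measurable_funM; first exact: measurable_tpowR.
  by apply: (measurableT_comp (@measurable_expR R)); exact: measurable_funN.
move=> s _; rewrite [X in (X <= _)%E]/= [X in (_ <= `|X|)%E]/= patchE.
have e0 t : 0 <= exponential_pdf 2^-1 t :> R by exact/exponential_pdf_ge0/ltW.
have C0 : 0 < C by rewrite mulr_gt0 ?expR_gt0.
have q0 : 0 <= tpowR r s * expR (- s) by rewrite mulr_ge0 ?tpowR_ge0 ?expR_ge0.
have [s0|s0] := leP s 0.
  by rewrite {1}/tpowR ltNge s0 mul0r normr0 abse_ge0.
case: ifPn => [|].
  rewrite inE/= in_itv/= => /andP[_ s1]; rewrite lee_fin !ger0_norm//; last first.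
    by rewrite addr_ge0 ?tpowR_ge0// mulr_ge0// ltW.
  rewrite ler_wpDr ?mulr_ge0 ?(ltW C0)//.
  by rewrite ler_piMr ?tpowR_ge0// -expR0 ler_expR oppr_le0 ltW.
rewrite notin_setE/= in_itv/= s0/= => /negP; rewrite -ltNge => s1.
rewrite add0r lee_fin !ger0_norm ?mulr_ge0 ?(ltW C0) ?tpowR_ge0 ?expR_ge0//.
rewrite (exponential_pdfE _ (ltW s0)) /C mulrACA divff// mul1r -expRD.
rewrite tpowR_exp// mulrAC -expRD.
rewrite ler_pdivrMr//.
rewrite (@le_trans _ _ (expR (r * ln (2 * r) + - 2^-1 * s)))//; last first.
  by rewrite ler_peMr ?expR_ge0// ltW.
have r2 : 0 < 2 * r by rewrite mulr_gt0.
have := ltW (ln_sublinear (divr_gt0 s0 r2)).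
rewrite ln_div ?posrE// ler_pdivlMr// => H.
rewrite ler_expR; lra.
Qed.

End PowerKernel.

(** * Euler's Beta integral *)

Section GammaBeta.
Variable R : realType.
Notation RT := (measurableTypeR R).
Notation mu := (@lebesgue_measure R).
Implicit Types (s t u : R) (z w : R[i]).

(** The integrand of Gamma z, and its modulus [gammaKR]. *)
Definition gammaK z s : R[i] := tpow z s * (expR (- s))%:C.
Definition gammaKR (r : R) s : R := tpowR r s * expR (- s).

(** The Gamma function of a positive real argument, as a real number. *)
Definition GammaR (r : R) : R := \int[mu]_s gammaKR r s.

Lemma normc_gammaK z s : normc (gammaK z s) = gammaKR (Re z) s.
Proof.
by rewrite ComplexField.Normc.normcM normc_tpow normc_real ger0_norm ?expR_ge0.
Qed.

Lemma gammaKR_ge0 (r s : R) : 0 <= gammaKR r s.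
Proof. by rewrite mulr_ge0 ?tpowR_ge0 ?expR_ge0. Qed.

Let measurable_expRN : measurable_fun setT (fun s : RT => expR (- s)).
Proof.
by apply: (measurableT_comp (@measurable_expR R)); exact: measurable_funN.
Qed.

Lemma cmeasurable_gammaK z : cmeasurable setT (gammaK z : RT -> R[i]).
Proof.
by apply: cmeasurableM; [exact: cmeasurable_tpow|exact: cmeasurable_real].
Qed.

Lemma measurable_gammaKR r : measurable_fun setT (gammaKR r : RT -> R).
Proof. by apply: measurable_funM => //; exact: measurable_tpowR. Qed.

Lemma cintegrable_gammaK z : 0 < Re z -> cintegrable setT (gammaK z).
Proof.
move=> z0; apply: (cintegrable_dom _ _ (integrable_tpowR_exp z0)) => //.
  exact: cmeasurable_gammaK.
by move=> s _; rewrite normc_gammaK.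
Qed.

Lemma integral_gammaKR (r : R) : 0 < r ->
  (\int[mu]_s (gammaKR r s)%:E = (GammaR r)%:E)%E.
Proof.
by move=> r0; rewrite /GammaR /Rintegral fineK//; apply: integrable_fin_num => //;
  exact: integrable_tpowR_exp.
Qed.

Lemma cintegral_gammaK_real (r : R) : cintegral setT (gammaK r%:C) = (GammaR r)%:C.
Proof.
have E s : gammaK r%:C s = (gammaKR r s)%:C by rewrite /gammaK tpow_real -rmorphM.
apply: complex_ext.
  by rewrite /=; apply: eq_Rintegral => s _; rewrite E.
rewrite /= /Rintegral (eq_integral (cst 0%E)) ?integral0//.
by move=> s _; rewrite E.
Qed.

(** On ]0, 1[ the integrand is at least s^(r - 1) / e, whose integral is
    1 / (e r). *)
Lemma GammaR_gt0 (r : R) : 0 < r -> 0 < GammaR r.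
Proof.
move=> r0.
have mD : measurable (`]0%R, 1%R[%classic : set RT) by exact: measurable_itv.
have rr : 0 < Re (r%:C : R[i]) by [].
have H : (\int[mu]_(s in `]0%R, 1%R[) (tpowR r s)%:E = (r^-1)%:E)%E.
  have /(congr1 (@complex.Re R)) := cintegral_tpow01 rr.
  rewrite -fmorphV/= /Rintegral => <-.
  rewrite fineK//; last first.
    have [+ _] : cintegrable `]0%R, 1%R[%classic (tpow r%:C).
      apply: cintegrable_tpow01 => // s /=.
      by rewrite !in_itv/= => /andP[-> /ltW].
    exact: integrable_fin_num.
  by apply: eq_integral => s _; rewrite tpow_real.
rewrite -lte_fin -integral_gammaKR//.
apply: (@lt_le_trans _ _ (\int[mu]_(s in `]0%R, 1%R[) (gammaKR r s)%:E)%E); last first.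
  apply: ge0_subset_integral => //.
    by apply/measurable_EFinP; exact: measurable_gammaKR.
  by move=> s _; rewrite lee_fin gammaKR_ge0.
apply: (@lt_le_trans _ _
    (\int[mu]_(s in `]0%R, 1%R[) ((expR (-1))%:E * (tpowR r s)%:E))%E).
  rewrite ge0_integralZl_EFin ?expR_ge0//; last 2 first.
  - by move=> s _; rewrite lee_fin tpowR_ge0.
  - by apply/measurable_EFinP; apply: measurable_funTS; exact: measurable_tpowR.
  by rewrite H -EFinM lte_fin mulr_gt0 ?expR_gt0 ?invr_gt0.
apply: ge0_le_integral => //.
- by move=> s _; rewrite -EFinM lee_fin mulr_ge0 ?expR_ge0 ?tpowR_ge0.
- apply/measurable_EFinP; apply: measurable_funM => //.
  by apply: measurable_funTS; exact: measurable_tpowR.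
- by apply/measurable_EFinP; apply: measurable_funTS; exact: measurable_gammaKR.
- move=> s /=; rewrite in_itv/= => /andP[_ s1].
  by rewrite lee_fin mulrC ler_wpM2l ?tpowR_ge0// ler_expR lerN2 ltW.
Qed.

(** The integrand of B(z, w), extended by 0 outside ]0, 1[, and its modulus
    [betaKR]. *)
Definition betaK z w s : R[i] := tpow z s * tpow w (1 - s).
Definition betaKR (p q : R) s : R := tpowR p s * tpowR q (1 - s).

Lemma normc_betaK z w s : normc (betaK z w s) = betaKR (Re z) (Re w) s.
Proof. by rewrite ComplexField.Normc.normcM !normc_tpow. Qed.

Lemma betaKR_ge0 (p q s : R) : 0 <= betaKR p q s.
Proof. by rewrite mulr_ge0 ?tpowR_ge0. Qed.

Let measurable_onem : measurable_fun setT (fun s : RT => 1 - s).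
Proof. exact: measurable_funB. Qed.

Lemma cmeasurable_betaK z w : cmeasurable setT (betaK z w : RT -> R[i]).
Proof.
apply: cmeasurableM; first exact: cmeasurable_tpow.
exact: (cmeasurableT_comp (cmeasurable_tpow w) measurable_onem).
Qed.

Lemma measurable_betaKR p q : measurable_fun setT (betaKR p q : RT -> R).
Proof.
apply: measurable_funM; first exact: measurable_tpowR.
exact: (measurableT_comp (measurable_tpowR q) measurable_onem).
Qed.

(** The convolution s^(z - 1) (u - s)^(w - 1) on ]0, u[ is a rescaled Beta
    integrand; this is what makes Gamma (z + w) appear. *)
Lemma scale_betaK z w s u : 0 < u ->
  tpow z s * tpow w (u - s) =
  cpow u (z - 1) * cpow u (w - 1) * betaK z w (u^-1 * s + 0).
Proof.
move=> u0; have un : u != 0 by rewrite gt_eqF.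
have -> : tpow z s = cpow u (z - 1) * tpow z (u^-1 * s).
  by rewrite -tpowM// mulrA mulfV// mul1r.
have -> : tpow w (u - s) = cpow u (w - 1) * tpow w (1 - u^-1 * s).
  by rewrite -tpowM//; congr tpow; rewrite mulrBr mulr1 mulrA mulfV// mul1r.
rewrite /betaK addr0; ring.
Qed.

Lemma scale_betaKR (p q s u : R) : 0 < u ->
  tpowR p s * tpowR q (u - s) =
  u `^ (p - 1) * u `^ (q - 1) * betaKR p q (u^-1 * s + 0).
Proof.
move=> u0; have un : u != 0 by rewrite gt_eqF.
have -> : tpowR p s = u `^ (p - 1) * tpowR p (u^-1 * s).
  by rewrite -tpowRM// mulrA mulfV// mul1r.
have -> : tpowR q (u - s) = u `^ (q - 1) * tpowR q (1 - u^-1 * s).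
  by rewrite -tpowRM//; congr tpowR; rewrite mulrBr mulr1 mulrA mulfV// mul1r.
rewrite /betaKR addr0; ring.
Qed.

Lemma conv_le0 z w s u : u <= 0 -> tpow z s * tpow w (u - s) = 0.
Proof.
move=> u0; rewrite /tpow; case: ltP => s0; last by rewrite mul0r.
by rewrite subr_gt0 ltNge (le_trans u0 (ltW s0))/= mulr0.
Qed.

Lemma convr_le0 (p q s u : R) : u <= 0 -> tpowR p s * tpowR q (u - s) = 0.
Proof.
move=> u0; rewrite /tpowR; case: ltP => s0; last by rewrite mul0r.
by rewrite subr_gt0 ltNge (le_trans u0 (ltW s0))/= mulr0.
Qed.

(** The integrand of Gamma z * Gamma w, as a double integral in s and t, written
    in the variables s and u = s + t; [Fr] is its modulus. *)
Let F z w (su : RT * RT) : R[i] :=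
  tpow z su.1 * tpow w (su.2 - su.1) * (expR (- su.2))%:C.
Let Fr (p q : R) (su : RT * RT) : R :=
  tpowR p su.1 * tpowR q (su.2 - su.1) * expR (- su.2).

Let normcF z w su : normc (F z w su) = Fr (Re z) (Re w) su.
Proof.
rewrite !ComplexField.Normc.normcM !normc_tpow normc_real.
by rewrite ger0_norm ?expR_ge0.
Qed.

Let mF z w : cmeasurable setT (F z w).
Proof.
have msub : measurable_fun setT (fun su : RT * RT => su.2 - su.1).
  by apply: measurable_funB; [exact: measurable_snd|exact: measurable_fst].
apply: cmeasurableM; first apply: cmeasurableM.
- exact: (cmeasurableT_comp (cmeasurable_tpow z) measurable_fst).
- exact: (cmeasurableT_comp (cmeasurable_tpow w) msub).
- apply: cmeasurable_real.
  exact: (measurableT_comp measurable_expRN measurable_snd).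
Qed.

Let FE1 z w s u : F z w (s, u) = gammaK z s * gammaK w (1 * u + - s).
Proof.
rewrite /F /gammaK /= mul1r opprB expRD mulrACA -rmorphM/=; congr (_ * _%:C).
by rewrite mulrA -expRD addNr expR0 mul1r.
Qed.

Let FrE1 (p q s u : R) : Fr p q (s, u) = gammaKR p s * gammaKR q (1 * u + - s).
Proof.
rewrite /Fr /gammaKR /= mul1r opprB expRD mulrACA; congr (_ * _).
by rewrite mulrA -expRD addNr expR0 mul1r.
Qed.

(** Integrating first in u separates the variables again, by translation. *)
Let Fr1 (p q : R) : 0 < p -> 0 < q ->
  (\int[mu]_s \int[mu]_u (Fr p q (s, u))%:E = (GammaR p * GammaR q)%:E)%E.
Proof.
move=> p0 q0.
have E s : (\int[mu]_u (Fr p q (s, u))%:E = (GammaR q)%:E * (gammaKR p s)%:E)%E.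
  under eq_integral do rewrite FrE1 EFinM.
  rewrite ge0_integralZl_EFin ?gammaKR_ge0//; last 2 first.
  - by move=> u _; rewrite lee_fin gammaKR_ge0.
  - apply/measurable_EFinP.
    exact: (measurableT_comp (measurable_gammaKR q) (measurable_affine 1 (- s))).
  rewrite muleC; congr (_ * _)%E; rewrite -(integral_gammaKR q0).
  rewrite (ge0_integral_affine (- s) (oner_neq0 R))//.
  - by rewrite normr1 mul1e.
  - by apply/measurable_EFinP; exact: measurable_gammaKR.
  - by move=> u; rewrite lee_fin gammaKR_ge0.
under eq_integral do rewrite E.
rewrite ge0_integralZl_EFin ?(ltW (GammaR_gt0 _))//; last 2 first.
- by move=> s _; rewrite lee_fin gammaKR_ge0.
- by apply/measurable_EFinP; exact: measurable_gammaKR.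
by rewrite (integral_gammaKR p0) -EFinM mulrC.
Qed.

(** Integrating first in s gives B(p, q) u^(p + q - 1) e^(-u), by scaling. *)
Let Fr2 (p q : R) : 0 < p -> 0 < q ->
  (\int[mu]_u \int[mu]_s (Fr p q (s, u))%:E =
   (\int[mu]_s (betaKR p q s)%:E) * (GammaR (p + q))%:E)%E.
Proof.
move=> p0 q0; set B := (X in (X * _)%E).
have B0 : (0 <= B)%E by apply: integral_ge0 => s _; rewrite lee_fin betaKR_ge0.
have E u : (\int[mu]_s (Fr p q (s, u))%:E = B * (gammaKR (p + q) u)%:E)%E.
  have [u0|u0] := leP u 0.
    rewrite integral0_eq => [|s _]; last by rewrite /Fr/= convr_le0// mul0r.
    by rewrite /gammaKR /tpowR ltNge u0/= mul0r mule0.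
  under eq_integral do rewrite /Fr /= scale_betaKR// mulrAC EFinM.
  have mb : measurable_fun setT (fun s : RT => (betaKR p q s)%:E).
    by apply/measurable_EFinP; exact: measurable_betaKR.
  have un0 : u^-1 != 0 by rewrite invr_eq0 gt_eqF.
  rewrite ge0_integralZl_EFin//; last 3 first.
  - by move=> s _; rewrite lee_fin betaKR_ge0.
  - exact: (measurableT_comp mb (measurable_affine u^-1 0)).
  - by rewrite !mulr_ge0 ?powR_ge0 ?expR_ge0.
  have b0 s : (0 <= (betaKR p q s)%:E)%E by rewrite lee_fin betaKR_ge0.
  rewrite {1}/B (ge0_integral_affine 0 un0 mb b0).
  rewrite gtr0_norm ?invr_gt0// muleAC -EFinM.
  congr (_%:E * _)%E; rewrite /gammaKR mulrA; congr (_ * _).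
  rewrite /tpowR u0 (_ : p + q - 1 = (p - 1) + (q - 1) + 1); last by ring.
  rewrite !(@powRD _ u) ?(gt_eqF u0) ?implybT// powRr1 ?ltW//.
  by rewrite [RHS]mulrC mulfK ?gt_eqF.
under eq_integral do rewrite E.
rewrite ge0_integralZl//.
- by rewrite integral_gammaKR// addr_gt0.
- by apply/measurable_EFinP; exact: measurable_gammaKR.
- by move=> u _; rewrite lee_fin gammaKR_ge0.
Qed.

(** Euler's relation for real arguments, by Tonelli's theorem.  It is an identity
    of extended reals; the finiteness of B(p, q) is deduced from it. *)
Lemma integral_betaKR (p q : R) : 0 < p -> 0 < q ->
  ((\int[mu]_s (betaKR p q s)%:E) * (GammaR (p + q))%:E =
   (GammaR p * GammaR q)%:E)%E.
Proof.
move=> p0 q0; rewrite -(Fr1 p0 q0) -(Fr2 p0 q0); apply/esym.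
have mFr : measurable_fun setT (EFin \o Fr p q).
  have := cmeasurable_normc (mF p%:C q%:C).
  have -> : (fun su => normc (F p%:C q%:C su)) = Fr p q.
    by apply/funext => su; rewrite normcF.
  by move=> ?; exact/measurable_EFinP.
apply: (fubini_tonelli (EFin \o Fr p q)) => // su.
by rewrite lee_fin !mulr_ge0 ?tpowR_ge0 ?expR_ge0.
Qed.

Lemma integrable_betaKR (p q : R) : 0 < p -> 0 < q ->
  mu.-integrable setT (EFin \o betaKR p q).
Proof.
move=> p0 q0; apply/integrableP; split.
  by apply/measurable_EFinP; exact: measurable_betaKR.
under eq_integral do rewrite /= ger0_norm ?betaKR_ge0//.
have := integral_betaKR p0 q0; have := GammaR_gt0 (addr_gt0 p0 q0).
case: (integral _ _ _) => [r||] //; first by rewrite ltry.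
by move=> G0; rewrite gt0_mulye.
Qed.

Lemma cintegrable_betaK z w : 0 < Re z -> 0 < Re w ->
  cintegrable setT (betaK z w).
Proof.
move=> z0 w0; apply: (cintegrable_dom _ _ (integrable_betaKR z0 w0)) => //.
  exact: cmeasurable_betaK.
by move=> s _; rewrite normc_betaK.
Qed.

(** Euler's relation B(z, w) Gamma (z + w) = Gamma z Gamma w: the same two
    computations as for real arguments, now exchanged by Fubini's theorem, whose
    integrability condition is the real case. *)
Lemma cintegral_betaK z w : 0 < Re z -> 0 < Re w ->
  cintegral setT (betaK z w) * cintegral setT (gammaK (z + w)) =
  cintegral setT (gammaK z) * cintegral setT (gammaK w).
Proof.
move=> z0 w0.
have iF1 s : cintegrable setT (fun u => F z w (s, u)).
  have := cintegrable_affine (- s) (oner_neq0 R) (cintegrable_gammaK w0).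
  move=> /(cintegrableZ (gammaK z s) measurableT).
  by apply: eq_cintegrable => // u _; rewrite FE1.
have iF2 u : cintegrable setT (fun s => F z w (s, u)).
  have ib := cintegrable_betaK z0 w0.
  have [u0|u0] := leP u 0.
    have := cintegrableZ 0 measurableT ib.
    by apply: eq_cintegrable => // s _; rewrite /F/= conv_le0// !mul0r.
  have un0 : u^-1 != 0 by rewrite invr_eq0 gt_eqF.
  have := cintegrable_affine 0 un0 ib.
  move=> /(cintegrableZ
    (cpow u (z - 1) * cpow u (w - 1) * (expR (- u))%:C) measurableT).
  apply: eq_cintegrable => // s _; rewrite /F/= scale_betaK//.
  by rewrite mulrAC.
have E1 s : cintegral setT (fun u => F z w (s, u)) =
    cintegral setT (gammaK w) * gammaK z s.
  have iw := cintegrable_affine (- s) (oner_neq0 R) (cintegrable_gammaK w0).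
  have EZ : cintegral setT (fun u : RT => gammaK z s * gammaK w (1 * u + - s)) =
      gammaK z s * cintegral setT (fun u : RT => gammaK w (1 * u + - s)).
    exact: (cintegralZ (gammaK z s) measurableT iw).
  transitivity (cintegral setT (fun u : RT => gammaK z s * gammaK w (1 * u + - s))).
    by apply: eq_cintegral => u _; rewrite FE1.
  rewrite EZ (cintegral_affine (- s) (oner_neq0 R) (cintegrable_gammaK w0)).
  by rewrite normr1 mul1r mulrC.
have ib := cintegrable_betaK z0 w0.
have E2 u : cintegral setT (fun s => F z w (s, u)) =
    cintegral setT (betaK z w) * gammaK (z + w) u.
  have [u0|u0] := leP u 0.
    transitivity (cintegral setT (fun s : RT => 0 * betaK z w s)).
      by apply: eq_cintegral => s _; rewrite /F/= conv_le0// !mul0r.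
    have -> : cintegral setT (fun s : RT => 0 * betaK z w s) =
        0 * cintegral setT (betaK z w).
      exact: (cintegralZ 0 measurableT ib).
    by rewrite mul0r /gammaK /tpow ltNge u0 mul0r mulr0.
  have un0 : u^-1 != 0 by rewrite invr_eq0 gt_eqF.
  set c := cpow u (z - 1) * cpow u (w - 1) * (expR (- u))%:C.
  transitivity (cintegral setT (fun s : RT => c * betaK z w (u^-1 * s + 0))).
    by apply: eq_cintegral => s _; rewrite /F/= scale_betaK// mulrAC.
  have -> : cintegral setT (fun s : RT => c * betaK z w (u^-1 * s + 0)) =
      c * cintegral setT (fun s : RT => betaK z w (u^-1 * s + 0)).
    exact: (cintegralZ c measurableT (cintegrable_affine 0 un0 ib)).
  rewrite (cintegral_affine 0 un0 ib) gtr0_norm ?invr_gt0//.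
  rewrite [RHS]mulrAC; congr (_ * _).
  rewrite /c /gammaK [RHS]mulrA; congr (_ * _).
  have -> : z + w = (z - 1) + (w - 1) + 1 + 1 by ring.
  rewrite /tpow u0 addrK (cpowD (z - 1 + (w - 1)) 1 u0) (cpowD (z - 1) (w - 1) u0).
  have -> : cpow u 1 = u%:C by exact: (cpow_nat 1 u0).
  by rewrite [RHS]mulrC -[RHS]mulrA -rmorphM/= mulfV ?gt_eqF// mulr1.
have izw : cintegrable setT (gammaK (z + w)).
  by apply: cintegrable_gammaK; rewrite ReD addr_gt0.
transitivity (cintegral setT (fun u => cintegral setT (fun s => F z w (s, u)))).
  transitivity (cintegral setT
      (fun u : RT => cintegral setT (betaK z w) * gammaK (z + w) u)).
    by apply/esym; exact: (cintegralZ _ measurableT izw).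
  by apply: eq_cintegral => u _; rewrite E2.
rewrite -(cintegral_Fubini (mF z w) _ iF1 iF2); last first.
  under eq_integral do under eq_integral do rewrite normcF.
  by rewrite Fr1// ltry.
transitivity (cintegral setT (fun s : RT => cintegral setT (gammaK w) * gammaK z s)).
  by apply: eq_cintegral => s _; rewrite E1.
by rewrite [RHS]mulrC; exact: (cintegralZ _ measurableT (cintegrable_gammaK z0)).
Qed.

End GammaBeta.

(** * The Gamma function on the right half-plane *)

Section GammaFunction.
Variable R : realType.
Notation RT := (measurableTypeR R).
Notation mu := (@lebesgue_measure R).
Implicit Types (s t u : R) (z w : R[i]).

Lemma Gamma_intE z : Gamma_int z = cintegral setT (gammaK z).
Proof.
rewrite /Gamma_int cintegral_mkcond; apply: eq_cintegral => s _.
rewrite mem_setE in_itv/= andbT /gammaK /tpow; case: ifP => //.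
by rewrite mul0r.
Qed.

Lemma GammaE z : 0 < Re z -> Gamma z = cintegral setT (gammaK z).
Proof.
move=> z0; rewrite /Gamma.
have -> : Num.truncn (1 - Re z) = 0%N.
  by apply/eqP; rewrite -leqn0 truncn_le_nat ltrBlDr ltrDl.
by rewrite big_ord0 divr1 addr0 Gamma_intE.
Qed.

Lemma Gamma_real (r : R) : 0 < r -> Gamma r%:C = (GammaR r)%:C.
Proof. by move=> r0; rewrite GammaE// cintegral_gammaK_real. Qed.

Lemma GammaR1 : GammaR 1 = 1 :> R.
Proof.
apply/EFin_inj; rewrite -integral_gammaKR//.
rewrite -(integral_exponential_pdf (ltr01 : 0 < (1 : R))).
transitivity (\int[mu]_(s in `]0%R, +oo[) (expR (- s))%:E)%E.
  rewrite [RHS]integral_mkcond; apply: eq_integral => s _.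
  rewrite patchE mem_setE in_itv/= andbT /gammaKR /tpowR.
  by case: ifP => _; rewrite ?mul0r// subrr powRr0 mul1r.
rewrite integral_itv_obnd_cbnd; last first.
  apply/measurable_EFinP; apply: measurable_funTS.
  by apply: (measurableT_comp (@measurable_expR R)); exact: measurable_funN.
rewrite [LHS]integral_mkcond; apply: eq_integral => s _.
rewrite /exponential_pdf !patchE; case: ifP => _ //.
by rewrite mul1r mulN1r.
Qed.

Lemma cintegral_betaK01 z w : cintegral setT (betaK z w) =
  cintegral `]0%R, 1%R[%classic (fun s => cpow s (z - 1) * cpow (1 - s) (w - 1)).
Proof.
rewrite [RHS]cintegral_mkcond; apply: eq_cintegral => s _.
rewrite mem_setE in_itv/= /betaK /tpow subr_gt0.
by case: (0 < s); case: (s < 1); rewrite ?mul0r ?mulr0.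
Qed.

Lemma beta_Gamma z w : 0 < Re z -> 0 < Re w ->
  cintegral setT (betaK z w) * Gamma (z + w) = Gamma z * Gamma w.
Proof.
by move=> z0 w0; rewrite !GammaE ?ReD ?addr_gt0//; exact: cintegral_betaK.
Qed.

(** Euler's relation for w = 1, where B(z, 1) = 1 / z and Gamma 1 = 1. *)
Lemma GammaS z : 0 < Re z -> Gamma (z + 1) = z * Gamma z.
Proof.
move=> z0; have o0 : 0 < Re (1 : R[i]) by [].
have zn0 : z != 0 by apply: contraTneq z0 => ->; rewrite ltxx.
have := beta_Gamma z0 o0.
rewrite (_ : (1 : R[i]) = 1%:C)// (Gamma_real ltr01) GammaR1.
rewrite cintegral_betaK01.
rewrite (@eq_cintegral _ _ _ (tpow z)); last first.
  move=> s; rewrite inE/= in_itv/= => /andP[s0 s1].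
  rewrite subrr /tpow s0 -[RHS]mulr1; congr (_ * _).
  by rewrite (cpow_nat 0) ?subr_gt0.
rewrite cintegral_tpow01// mulr1 => H.
by rewrite -H mulrA mulfV// mul1r.
Qed.

Lemma GammaRS (r : R) : 0 < r -> GammaR (r + 1) = r * GammaR r.
Proof.
move=> r0; have rr : 0 < Re (r%:C : R[i]) by [].
apply/complexI; rewrite rmorphM/= -!Gamma_real ?addr_gt0//.
by rewrite rmorphD; exact: GammaS.
Qed.

Lemma le_normc_Gamma z : 0 < Re z -> normc (Gamma z) <= GammaR (Re z).
Proof.
move=> z0; rewrite GammaE//.
apply: (le_trans (le_normc_cintegral measurableT (cintegrable_gammaK z0))).
rewrite le_eqVlt; apply/orP; left; apply/eqP.
by apply: eq_Rintegral => s _; rewrite normc_gammaK.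
Qed.

(** For x >= 1 put x = v^2: then 0 <= ln x = 2 ln v <= 2 (v - 1) <= 2 (v - 1/v),
    and the square of v - 1/v is x - 2 + 1/x.  Both sides are invariant under
    x -> 1/x.  In this form the bound integrates against the Gamma kernel to
    neighbouring values of Gamma. *)
Lemma sqr_ln_le (x : R) : 0 < x -> ln x ^+ 2 <= 4 * (x - 2 + x^-1).
Proof.
suff H (y : R) : 1 <= y -> ln y ^+ 2 <= 4 * (y - 2 + y^-1).
  move=> x0; have [x1|/ltW x1] := leP 1 x; first exact: H.
  have := H x^-1; rewrite invf_ge1// lnV ?posrE// sqrrN invrK => /(_ x1).
  by move=> /le_trans; apply; rewrite ler_pM2l//; lra.
move=> y1; have y0 : 0 < y by exact: lt_le_trans y1.
have [v v1 yv] : exists2 v, 1 <= v & y = v ^+ 2.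
  exists (Num.sqrt y); last by rewrite sqr_sqrtr// ltW.
  by rewrite -sqrtr1 ler_sqrt// ltW.
have v0 : 0 < v by exact: lt_le_trans v1.
have lnv0 : 0 <= ln v by exact: ln_ge0.
have lnv : ln v <= v - 1.
  have := @le_ln1Dx R (v - 1); rewrite addrCA subrr addr0; apply; lra.
have vV : v^-1 <= 1 by rewrite invf_le1.
have vV0 : 0 < v^-1 by rewrite invr_gt0.
have vvV : v * v^-1 = 1 by rewrite mulfV ?gt_eqF.
have -> : y - 2 + y^-1 = (v - v^-1) ^+ 2.
  by rewrite yv -exprVn sqrrB vvV; ring.
rewrite yv lnXn// (_ : (ln v *+ 2) ^+ 2 = 4 * ln v ^+ 2); last by ring.
rewrite ler_pM2l// ler_pXn2r ?nnegrE//; lra.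
Qed.

Lemma le_norm_sin (x : R) : `|sin x| <= `|x|.
Proof.
suff H (y : R) : 0 <= y -> `|sin y| <= y.
  have [x0|/ltW x0] := leP 0 x; first by rewrite (ger0_norm x0) H.
  by rewrite (ler0_norm x0) -normrN -sinN H// oppr_ge0.
move=> y0.
have cs : {within `[0, y], continuous (@sin R)}.
  by apply: continuous_subspaceT; exact: continuous_sin.
have [c _] := MVT_segment y0 (fun t _ => is_derive_sin t) cs.
rewrite sin0 !subr0 => ->.
by rewrite normrM (ger0_norm y0) ler_piMl// cos_max.
Qed.

Lemma cos_ge (x : R) : 1 - x ^+ 2 / 2 <= cos x.
Proof.
have -> : cos x = 1 - 2 * sin (x / 2) ^+ 2.
  have {1}-> : x = (x / 2) *+ 2 by rewrite -mulr_natr; field.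
  rewrite cos_mulr2n cos2sin2; ring.
have : `|sin (x / 2)| ^+ 2 <= `|x / 2| ^+ 2.
  by rewrite ler_pXn2r ?nnegrE//; exact: le_norm_sin.
rewrite !real_normK ?num_real//; nra.
Qed.

Lemma gammaKRS (r s : R) : gammaKR (r + 1) s = s * gammaKR r s.
Proof.
rewrite /gammaKR /tpowR; case: ltP => s0; last by rewrite mul0r mulr0.
rewrite mulrA addrAC (@powRD _ s (r - 1)) ?(gt_eqF s0) ?implybT//.
by rewrite powRr1 ?ltW// [s * _]mulrC.
Qed.

Lemma Re_rotated_gammaK z s (q : R) :
  Re ((cos q -i* sin q) * gammaK z s) = gammaKR (Re z) s * cos (Im z * ln s - q).
Proof.
rewrite ReM /gammaK /tpow /gammaKR /tpowR; case: ifP => _; last first.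
  by rewrite !mul0r /= !mulr0 subr0.
rewrite /cpow ReD ImD !(ReM, ImM) /= oppr0 addr0 cosB; ring.
Qed.

(** With p = Re z and q = Im z, multiplication by the unimodular p^(-iq) turns the
    phase of the integrand into q ln (s/p), which is small where the mass of the
    kernel lies.  By [cos_ge] and [sqr_ln_le] the real part of the integrand is at
    least s^(p - 1) e^(-s) (1 - 2 q^2 (s/p - 2 + p/s)), which integrates to
    a combination of Gamma (p + 1), Gamma p and Gamma (p - 1). *)
Lemma Gamma_lower_bound z : 1 < Re z ->
  GammaR (Re z) * (1 - 2 * Im z ^+ 2 / (Re z - 1)) <= normc (Gamma z).
Proof.
move=> z1; have z0 : 0 < Re z by exact: lt_trans z1.
set p := Re z in z1 z0 *; set q := Im z.
have p10 : 0 < p - 1 by rewrite subr_gt0.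
have pS : p - 1 + 1 = p by rewrite subrK.
set rot := cos (q * ln p) -i* sin (q * ln p).
have nrot : normc rot = 1 by rewrite /= sqrrN cos2Dsin2 sqrtr1.
have -> : normc (Gamma z) = normc (rot * Gamma z).
  by rewrite [RHS]ComplexField.Normc.normcM nrot mul1r.
apply: le_trans (le_Re_normc _); apply: le_trans (ler_norm _).
rewrite (GammaE z0).
have irot := cintegrableZ rot measurableT (cintegrable_gammaK z0).
have -> : rot * cintegral setT (gammaK z) =
    cintegral setT (fun s : RT => rot * gammaK z s).
  by apply/esym; exact: (cintegralZ rot measurableT (cintegrable_gammaK z0)).
(* 1 - 2 q^2 (s/p - 2 + p/s) = A s + B + C/s *)
pose A := - (2 * q ^+ 2) / p.
pose B := 1 + 4 * q ^+ 2.
pose C := - (2 * q ^+ 2) * p.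
have i1 : mu.-integrable setT (EFin \o gammaKR (p + 1)).
  by apply: integrable_tpowR_exp; rewrite addr_gt0.
have i2 : mu.-integrable setT (EFin \o gammaKR p) by exact: integrable_tpowR_exp.
have i3 : mu.-integrable setT (EFin \o gammaKR (p - 1)) by exact: integrable_tpowR_exp.
have j1 := integrableZl measurableT A i1.
have j2 := integrableZl measurableT B i2.
have j3 := integrableZl measurableT C i3.
have j12 := integrableD measurableT j1 j2.
have j123 := integrableD measurableT j12 j3.
have -> : GammaR p * (1 - 2 * q ^+ 2 / (p - 1)) =
    \int[mu]_s (A * gammaKR (p + 1) s + B * gammaKR p s + C * gammaKR (p - 1) s).
  have -> : \int[mu]_s
        (A * gammaKR (p + 1) s + B * gammaKR p s + C * gammaKR (p - 1) s) =
      \int[mu]_s (A * gammaKR (p + 1) s + B * gammaKR p s) +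
      \int[mu]_s (C * gammaKR (p - 1) s).
    exact: (RintegralD measurableT j12 j3).
  have -> : \int[mu]_s (A * gammaKR (p + 1) s + B * gammaKR p s) =
      \int[mu]_s (A * gammaKR (p + 1) s) + \int[mu]_s (B * gammaKR p s).
    exact: (RintegralD measurableT j1 j2).
  rewrite (RintegralZl A measurableT i1) (RintegralZl B measurableT i2).
  rewrite (RintegralZl C measurableT i3).
  rewrite -/(GammaR (p + 1)) -/(GammaR p) -/(GammaR (p - 1)).
  rewrite (GammaRS z0) -[X in GammaR X * _]pS -[X in B * GammaR X]pS.
  rewrite -[X in p * GammaR X]pS (GammaRS p10).
  rewrite /A /B /C; field.
  by rewrite !gt_eqF.
apply: le_Rintegral => //; first by case: irot.
move=> s _; rewrite Re_rotated_gammaK -/p -/q.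
have [s0|s0] := ltP 0 s; last first.
  by rewrite /gammaKR /tpowR ltNge s0/= !mul0r !mulr0 !addr0.
have -> : gammaKR (p + 1) s = s * gammaKR p s by exact: gammaKRS.
have -> : gammaKR (p - 1) s = s^-1 * gammaKR p s.
  by rewrite -{2}pS gammaKRS mulrA mulVf ?mul1r ?gt_eqF.
have g0 := gammaKR_ge0 p s; move: (gammaKR p s) g0 => g g0.
have -> : A * (s * g) + B * g + C * (s^-1 * g) = g * (A * s + B + C / s) by ring.
rewrite ler_wpM2l//.
apply: le_trans (cos_ge _).
have x0 : 0 < s / p by rewrite divr_gt0.
have := sqr_ln_le x0; rewrite ln_div ?posrE// invf_div => H.
rewrite -mulrBr exprMn.
have q2 : 0 <= q ^+ 2 by exact: sqr_ge0.
have -> : A * s + B + C / s = 1 - q ^+ 2 * (4 * (s / p - 2 + p / s)) / 2.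
  by rewrite /A /B /C; field; rewrite !gt_eqF.
by rewrite lerB// ler_pM2r ?invr_gt0// ler_wpM2l.
Qed.

(** On a horizontal half-line, |Gamma z| is at least a constant multiple of
    Gamma (Re z), and it is at most Gamma (Re z) by [le_normc_Gamma].  For large
    Re z the constant 1/2 serves by [Gamma_lower_bound]; the recurrence
    Gamma (z + 1) = z Gamma z then extends the bound to the left one unit at a
    time, losing each time a factor bounded below by p0 / (p0 + |q|). *)
Lemma Gamma_ge_real_Gamma (q p0 : R) : 0 < p0 -> exists2 c, 0 < c &
  forall z, Im z = q -> p0 <= Re z -> c * GammaR (Re z) <= normc (Gamma z).
Proof.
move=> p00.
suff [N] : exists N : nat, exists2 c, 0 < c &
    forall z, Im z = q -> p0 + N%:R <= Re z -> c * GammaR (Re z) <= normc (Gamma z).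
  elim: N => [[c c0 H]|N IH [c c0 H]].
    by exists c => // z zq zp; apply: H => //; rewrite addr0.
  apply: IH; exists (c * (p0 / (p0 + `|q|))).
    by rewrite mulr_gt0// divr_gt0// ltr_wpDr.
  move=> z zq zp.
  have z0 : 0 < Re z by apply: lt_le_trans zp; rewrite ltr_wpDr.
  have zp0 : p0 <= Re z by apply: le_trans zp; rewrite lerDl.
  have := H (z + 1); rewrite ReD ImD addr0 /= -natr1 addrA lerD2r GammaS// GammaRS//.
  rewrite ComplexField.Normc.normcM => /(_ zq zp) H1.
  have nz : normc z <= Re z + `|q|.
    by apply: le_trans (normc_le_ReIm z) _; rewrite zq (ger0_norm (ltW z0)).
  have q0 : 0 <= `|q| by [].
  have zq0 : 0 < Re z + `|q| by rewrite ltr_wpDr.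
  have H2 : c * (Re z * GammaR (Re z)) <= (Re z + `|q|) * normc (Gamma z).
    by apply: le_trans H1 _; rewrite ler_wpM2r ?normc_ge0.
  have H3 : p0 / (p0 + `|q|) <= Re z / (Re z + `|q|).
    rewrite ler_pdivrMr ?ltr_wpDr// mulrAC ler_pdivlMr//; nra.
  apply: (@le_trans _ _ (c * (Re z / (Re z + `|q|)) * GammaR (Re z))).
    by rewrite ler_wpM2r ?(ltW (GammaR_gt0 z0))// ler_pM2l.
  rewrite mulrA mulrAC ler_pdivrMr// mulrAC -mulrA [leRHS]mulrC; lra.
(* Re z > 2 + 4 q^2 gives 2 q^2 / (Re z - 1) <= 1/2. *)
exists (Num.truncn (2 + 4 * q ^+ 2)).+1, (2^-1); first by rewrite invr_gt0.
move=> z zq zp.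
have zl : 2 + 4 * q ^+ 2 < Re z.
  apply: lt_le_trans zp; apply: (lt_le_trans (truncnS_gt _)); rewrite lerDr; lra.
have q2 : 0 <= q ^+ 2 by exact: sqr_ge0.
have z1 : 1 < Re z by lra.
apply: le_trans (Gamma_lower_bound z1).
rewrite mulrC ler_pM2l ?GammaR_gt0//; last lra.
rewrite zq lerBrDr -lerBrDl ler_pdivrMr; lra.
Qed.

Lemma Gamma_neq0 z : 0 < Re z -> Gamma z != 0.
Proof.
move=> z0; have [c c0 H] := Gamma_ge_real_Gamma (Im z) z0.
rewrite -normc_gt0; apply: lt_le_trans (H z erefl (lexx _)).
by rewrite mulr_gt0 ?GammaR_gt0.
Qed.

End GammaFunction.

(** * Interchanging a double series and an integral *)

Section SquareSums.
Variable R : realType.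

Definition sqsum (V : nmodType) (a : nat -> nat -> V) (N : nat) : V :=
  \sum_(m < N) \sum_(n < N) a m n.

Lemma sqsum_nondecreasing (b : nat -> nat -> R) :
  (forall m n, 0 <= b m n) -> nondecreasing_seq (sqsum b).
Proof.
move=> b0; apply/nondecreasing_seqP => N; rewrite /sqsum big_ord_recr /=.
rewrite ler_wpDr ?sumr_ge0//; apply: ler_sum => m _.
by rewrite big_ord_recr /= lerDl.
Qed.

Lemma is_cvg_sqsum (b : nat -> nat -> R) (M : R) : (forall m n, 0 <= b m n) ->
  (forall N, sqsum b N <= M) -> cvgn (sqsum b).
Proof.
move=> b0 bM; apply: nondecreasing_is_cvgn; first exact: sqsum_nondecreasing.
by exists M => _ [N _ <-].
Qed.

Lemma abs_summable2_bound (a : nat -> nat -> R[i]) : abs_summable2 a ->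
  exists M, forall N, sqsum (fun m n => normc (a m n)) N <= M.
Proof.
move=> sa.
exists (fine (\esum_(p in [set: nat * nat]) `|(normc (a p.1 p.2))%:E|)%E) => N.
rewrite -lee_fin fineK; last by rewrite -summableE.
apply: esum_ge; exists (`I_N `*` `I_N); first by split => //; exact: finite_setX.
rewrite -(pair_fsbig _ (fun m n => `|(normc (a m n))%:E|)%E)//=.
rewrite -fsbig_ord /sqsum -sumEFin; apply: lee_sum => m _.
rewrite -fsbig_ord -sumEFin; apply: lee_sum => n _.
by rewrite lee_fin ler_norm.
Qed.

Definition ccvgn (u : nat -> R[i]) (l : R[i]) : Prop :=
  (fun N => Re (u N)) @ \oo --> Re l /\ (fun N => Im (u N)) @ \oo --> Im l.

Lemma csum2_lim (a : nat -> nat -> R[i]) l : ccvgn (sqsum a) l -> csum2 a = l.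
Proof.
move=> [c1 c2]; apply: complex_ext; rewrite /csum2 /=; exact/cvg_lim.
Qed.

Lemma ccvgnZ (c : R[i]) u l : ccvgn u l -> ccvgn (fun N => c * u N) (c * l).
Proof.
move=> [c1 c2]; split.
  under boolp.eq_fun do rewrite ReM.
  by rewrite ReM; apply: cvgB; apply: cvgMr.
under boolp.eq_fun do rewrite ImM.
by rewrite ImM; apply: cvgD; apply: cvgMr.
Qed.

Lemma sqsumZ (c : R[i]) a N : sqsum (fun m n => c * a m n) N = c * sqsum a N.
Proof.
rewrite /sqsum mulr_sumr; apply: eq_bigr => m _.
by rewrite mulr_sumr.
Qed.

Lemma csum2Z (c : R[i]) a l : ccvgn (sqsum a) l ->
  csum2 (fun m n => c * a m n) = c * l.
Proof.
move=> cl; apply: csum2_lim; rewrite (_ : sqsum _ = fun N => c * sqsum a N).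
  exact: ccvgnZ.
by apply/funext => N; rewrite sqsumZ.
Qed.

Lemma Re_sqsum (a : nat -> nat -> R[i]) N :
  Re (sqsum a N) = sqsum (fun m n => Re (a m n)) N.
Proof. by rewrite /sqsum Re_sum; apply: eq_bigr => m _; rewrite Re_sum. Qed.

Lemma Im_sqsum (a : nat -> nat -> R[i]) N :
  Im (sqsum a N) = sqsum (fun m n => Im (a m n)) N.
Proof. by rewrite /sqsum Im_sum; apply: eq_bigr => m _; rewrite Im_sum. Qed.

(** For p the real or the imaginary part, p a = (|a| + p a) - |a| is a difference
    of nonnegative terms with bounded square sums. *)
Lemma abs_summable2_cvg (a : nat -> nat -> R[i]) : abs_summable2 a ->
  ccvgn (sqsum a) (csum2 a).
Proof.
move=> /abs_summable2_bound[M aM].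
have key (p : R[i] -> R) : (forall z, `|p z| <= normc z) ->
    cvgn (sqsum (fun m n => p (a m n))).
  move=> np.
  have np' z : - normc z <= p z <= normc z by rewrite -ler_norml.
  have c1 : cvgn (sqsum (fun m n => normc (a m n))).
    by apply: is_cvg_sqsum aM => m n; exact: normc_ge0.
  have c2 : cvgn (sqsum (fun m n => normc (a m n) + p (a m n))).
    apply: (@is_cvg_sqsum _ (M + M)) => [m n|N].
      by have /andP[+ _] := np' (a m n); lra.
    apply: le_trans (lerD (aM N) (aM N)).
    rewrite /sqsum -big_split; apply: ler_sum => m _.
    rewrite -big_split; apply: ler_sum => n _ /=.
    by have /andP[_] := np' (a m n); lra.
  have -> : sqsum (fun m n => p (a m n)) =
      sqsum (fun m n => normc (a m n) + p (a m n)) -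
      sqsum (fun m n => normc (a m n)).
    apply/funext => N; rewrite /sqsum !fctE -sumrB; apply: eq_bigr => m _.
    by rewrite -sumrB; apply: eq_bigr => n _; rewrite addrAC subrr add0r.
  exact: is_cvgB.
have cRe : cvgn (fun N => Re (sqsum a N)).
  by rewrite (boolp.funext (Re_sqsum a)); exact: key (@le_Re_normc R).
have cIm : cvgn (fun N => Im (sqsum a N)).
  by rewrite (boolp.funext (Im_sqsum a)); exact: key (@le_Im_normc R).
by split; [exact: cRe|exact: cIm].
Qed.

Lemma normc_sqsum (a : nat -> nat -> R[i]) N :
  normc (sqsum a N) <= sqsum (fun m n => normc (a m n)) N.
Proof.
have ns (I : Type) (s : seq I) (F : I -> R[i]) :
    normc (\sum_(i <- s) F i) <= \sum_(i <- s) normc (F i).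
  elim: s => [|i s IH]; first by rewrite !big_nil ComplexField.Normc.normc0.
  rewrite !big_cons; apply: le_trans (le_normcD _ _) _.
  by rewrite lerD2l.
by apply: le_trans (ns _ _ _) _; apply: ler_sum => m _; exact: ns.
Qed.

End SquareSums.

(** ** Dominated convergence for square partial sums *)

Section Exchange.
Variable R : realType.
Notation RT := (measurableTypeR R).
Notation mu := (@lebesgue_measure R).
Variables (D : set RT) (t : nat -> nat -> RT -> R[i]) (f : RT -> R[i]) (M : R).
Hypothesis mD : measurable D.
Hypothesis it : forall m n, cintegrable D (t m n).
Hypothesis tf : forall s, D s -> ccvgn (sqsum (fun m n => t m n s)) (f s).
Hypothesis tM : forall N,
  sqsum (fun m n => \int[mu]_(s in D) normc (t m n s)) N <= M.

(** The partial sums [S] are dominated by the increasing limit [G] of the sums [A]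
    of moduli.  Monotone convergence makes [G] integrable, since the integrals of
    the [A N] are bounded by M. *)
Let S N s := sqsum (fun m n => t m n s) N.
Let A N s := sqsum (fun m n => normc (t m n s)) N.
Let G s := limn (fun N => (A N s)%:E).

Let cintegrable_cintegral_S N : cintegrable D (S N) /\
  cintegral D (S N) = sqsum (fun m n => cintegral D (t m n)) N.
Proof.
have H (m : nat) := cintegrable_cintegral_sum (index_enum 'I_N) mD
   (fun n : 'I_N => it m n).
have [i1 e1] := cintegrable_cintegral_sum (index_enum 'I_N) mD
   (fun m : 'I_N => (H m).1).
split; first exact: i1.
rewrite /S /sqsum [LHS]e1; apply: eq_bigr => m _.
exact: (H m).2.
Qed.

Let A_ge0 N s : 0 <= A N s.
Proof. by apply: sumr_ge0 => m _; apply: sumr_ge0 => n _; exact: normc_ge0. Qed.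

Let integrable_A N : mu.-integrable D (EFin \o A N) /\
  (\int[mu]_(s in D) (A N s)%:E <= M%:E)%E.
Proof.
have inorm m n := cintegrable_normc mD (it m n).
have E : EFin \o A N = fun s => (\sum_(m < N) \sum_(n < N) (normc (t m n s))%:E)%E.
  apply/funext => s; rewrite /A /sqsum /= -sumEFin.
  by apply: eq_bigr => m _; rewrite sumEFin.
have i1 (m : 'I_N) :
    mu.-integrable D (fun s => \sum_(n < N) (normc (t m n s))%:E)%E.
  by apply: integrable_sum => // n _; exact: inorm.
split; first by rewrite E; apply: integrable_sum => // m _; exact: i1.
rewrite -[X in integral _ _ X]/(EFin \o A N) E integral_sum//.
apply: le_trans
  (_ : (sqsum (fun m n => \int[mu]_(s in D) normc (t m n s)) N)%:E <= _)%E;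
  last by rewrite lee_fin.
rewrite /sqsum -sumEFin; apply: lee_sum => m _.
rewrite integral_sum// -sumEFin; apply: lee_sum => n _.
by rewrite /Rintegral fineK//; exact: integrable_fin_num.
Qed.

Let nd_A s : nondecreasing_seq (fun N => (A N s)%:E).
Proof.
move=> N N' NN'; rewrite lee_fin.
by apply: (sqsum_nondecreasing _ NN') => m n; exact: normc_ge0.
Qed.

Let integrable_G : mu.-integrable D G.
Proof.
have mA N : measurable_fun D (EFin \o A N) := measurable_int _ (integrable_A N).1.
have G0 s : (0 <= G s)%E.
  apply: lime_ge; first exact/ereal_nondecreasing_is_cvgn/nd_A.
  by apply: nearW => N; rewrite lee_fin.
apply/integrableP; split.
  refine (@emeasurable_fun_cvg _ _ _ _ _ _ mA _) => s _.
  exact/ereal_nondecreasing_is_cvgn/nd_A.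
under eq_integral do rewrite gee0_abs//.
rewrite /G monotone_convergence//.
- apply: (@le_lt_trans _ _ M%:E); last exact: ltry.
  apply: lime_le; last by apply: nearW => N; exact: (integrable_A N).2.
  apply: ereal_nondecreasing_is_cvgn => m n mn; apply: ge0_le_integral => //.
  + by move=> s _; rewrite lee_fin.
  + exact: mA.
  + exact: mA.
  + by move=> s _; exact: nd_A.
- by move=> N s _; rewrite lee_fin.
Qed.

Let key (p : R[i] -> R) : (forall z, `|p z| <= normc z) ->
  (forall N, mu.-integrable D (EFin \o (p \o S N))) ->
  (forall s, D s -> p (S N s) @[N --> \oo] --> p (f s)) ->
  mu.-integrable D (EFin \o (p \o f)) /\
  (fun N => \int[mu]_(s in D) p (S N s)) @ \oo --> \int[mu]_(s in D) p (f s).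
Proof.
move=> np ip cp.
have mp N : measurable_fun D (EFin \o (p \o S N)) := measurable_int _ (ip N).
have cE s : D s -> (EFin \o (p \o S N)) s @[N --> \oo] --> (EFin \o (p \o f)) s.
  by move=> Ds; apply: cvg_EFin; [exact: nearW|exact: cp].
have mf : measurable_fun D (EFin \o (p \o f)) := emeasurable_fun_cvg _ _ mp cE.
have dom s N : D s -> (`|(EFin \o (p \o S N)) s| <= G s)%E.
  move=> Ds; apply: (@le_trans _ _ (A N s)%:E).
    by rewrite /= lee_fin (le_trans (np _))// normc_sqsum.
  apply: lime_ge; first exact/ereal_nondecreasing_is_cvgn/nd_A.
  by exists N => // n /= Nn; exact: nd_A.
have [i1 _ c1] := dominated_convergence mD mp mf (aeW _ cE) integrable_G
   (aeW _ dom).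
split=> //; apply: fine_cvg; rewrite fineK; first exact: c1.
exact: integrable_fin_num.
Qed.

Lemma cintegral_sqsum : cintegrable D f /\
  ccvgn (sqsum (fun m n => cintegral D (t m n))) (cintegral D f).
Proof.
have iS N := (cintegrable_cintegral_S N).1.
have eS N := (cintegrable_cintegral_S N).2.
have [iRe cRe] := key (@le_Re_normc R) (fun N => (iS N).1)
  (fun s Ds => (tf Ds).1).
have [iIm cIm] := key (@le_Im_normc R) (fun N => (iS N).2)
  (fun s Ds => (tf Ds).2).
split; first by split.
split.
  by under boolp.eq_fun do rewrite -eS; exact: cRe.
by under boolp.eq_fun do rewrite -eS; exact: cIm.
Qed.

End Exchange.

(** * The integral representation *)

Section TermIntegrals.
Variable R : realType.
Notation RT := (measurableTypeR R).
Notation mu := (@lebesgue_measure R).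
Implicit Types (s : R) (z w : R[i]).

Lemma betaK01E z w s : 0 < s < 1 ->
  betaK z w s = cpow s (z - 1) * cpow (1 - s) (w - 1).
Proof. by move=> /andP[s0 s1]; rewrite /betaK /tpow s0 subr_gt0 s1. Qed.

Lemma betaKR_out p q s : s \notin (`]0%R, 1%R[%classic : set RT) ->
  betaKR p q s = 0 :> R.
Proof.
rewrite mem_setE in_itv/= /betaKR /tpowR subr_gt0.
by case: (0 < s); case: (s < 1); rewrite ?mul0r ?mulr0.
Qed.

Lemma cintegral01_betaK z w :
  cintegral `]0%R, 1%R[%classic (betaK z w) = cintegral setT (betaK z w).
Proof.
rewrite cintegral_betaK01; apply: eq_cintegral => s.
by rewrite inE/= in_itv/=; exact: betaK01E.
Qed.

Lemma Rintegral01_betaKR (p q : R) :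
  \int[mu]_(s in `]0%R, 1%R[) betaKR p q s = \int[mu]_s betaKR p q s.
Proof.
rewrite Rintegral_mkcond; apply: eq_Rintegral => s _; rewrite patchE.
by case: ifPn => // /betaKR_out ->.
Qed.

Lemma Rintegral_betaKR (p q : R) : 0 < p -> 0 < q ->
  (\int[mu]_s betaKR p q s) * GammaR (p + q) = GammaR p * GammaR q.
Proof.
move=> p0 q0; apply: EFin_inj; rewrite -integral_betaKR// EFinM; congr (_ * _)%E.
rewrite /Rintegral fineK//; apply: integrable_fin_num => //.
exact: integrable_betaKR.
Qed.

(** The poles of Gamma lie in Re z <= 0, so the quotient formula applies. *)
Lemma pochhammer_Gamma z (l : R) : 0 < Re z ->
  pochhammer z l = Gamma (z + l%:C) / Gamma z.
Proof.
move=> z0; rewrite /pochhammer /Gamma_pole.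
have -> : Num.truncn (- Re z) = 0%N.
  by apply/eqP; rewrite -leqn0 truncn_le_nat (@lt_trans _ _ 0)// oppr_lt0.
rewrite oppr0 (_ : z == 0 = false)//.
by apply: contraTF z0 => /eqP ->; rewrite ltxx.
Qed.

End TermIntegrals.

Theorem mainTheorem9 (R : realType)
    (g1 g2 g3 d1 d2 d3 x y : R[i])
    (a1 a2 a3 a4 b1 b2 b3 b4 : R)
    (hg2 : 0 < complex.Re g2) (hg3 : 0 < complex.Re g3)
    (ha1 : 0 < a1) (ha2 : 0 < a2) (ha3 : 0 < a3) (ha4 : 0 < a4)
    (hb1 : 0 < b1) (hb2 : 0 < b2) (hb3 : 0 < b3) (hb4 : 0 < b4)
    (hD1 : abs_summable2
       (D1_term g1 a1 b1 g2 a2 g3 b2 d1 a3 b3 d2 a4 d3 b4 x y))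
    (hD5 : forall xi : R, 0 < xi < 1 -> abs_summable2
       (D5_term g1 a1 b1 (g2 + g3) a2 b2 d1 a3 b3 d2 a4 d3 b4
          (x * (xi `^ a2)%:C) (y * ((1 - xi) `^ b2)%:C))) :
  let f := fun xi : R =>
    cpow xi (g2 - 1) * cpow (1 - xi) (g3 - 1) *
    D5 g1 a1 b1 (g2 + g3) a2 b2 d1 a3 b3 d2 a4 d3 b4
      (x * (xi `^ a2)%:C) (y * ((1 - xi) `^ b2)%:C) in
  cintegrable `]0, 1[ f /\
  D1 g1 a1 b1 g2 a2 g3 b2 d1 a3 b3 d2 a4 d3 b4 x y =
    Gamma (g2 + g3) / (Gamma g2 * Gamma g3) * cintegral `]0, 1[ f.
Proof.
move=> f.
pose mu := @lebesgue_measure R.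
have mD : measurable (`]0%R, 1%R[%classic : set (measurableTypeR R)).
  exact: measurable_itv.
have hg23 : 0 < Re (g2 + g3) by rewrite ReD addr_gt0.
(* Term by term, the integral is the Beta integral B(z m, w n); Q collects the
   factors that D1 and D5 share, and K m n is the coefficient of the Beta
   integrand in the integral of D5. *)
pose z (m : nat) := g2 + (a2 * m%:R)%:C.
pose w (n : nat) := g3 + (b2 * n%:R)%:C.
pose Q m n := pochhammer g1 (a1 * m%:R + b1 * n%:R) /
  Gamma (d1 + (a3 * m%:R + b3 * n%:R)%:C) *
  (x ^+ m / Gamma (d2 + (a4 * m%:R)%:C)) *
  (y ^+ n / Gamma (d3 + (b4 * n%:R)%:C)).
pose K m n := Q m n * (Gamma (z m + w n) / Gamma (g2 + g3)).
pose t m n s := K m n * betaK (z m) (w n) s.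
have am m : 0 <= a2 * m%:R by rewrite mulr_ge0// ltW.
have bn n : 0 <= b2 * n%:R by rewrite mulr_ge0// ltW.
have zm m : Re (z m) = Re g2 + a2 * m%:R by rewrite ReD.
have wn n : Re (w n) = Re g3 + b2 * n%:R by rewrite ReD.
have zm0 m : 0 < Re (z m) by rewrite zm ltr_wpDr.
have wn0 n : 0 < Re (w n) by rewrite wn ltr_wpDr.
have Imz m : Im (z m) = Im g2 by rewrite ImD addr0.
have Imw n : Im (w n) = Im g3 by rewrite ImD addr0.
have D1E m n : D1_term g1 a1 b1 g2 a2 g3 b2 d1 a3 b3 d2 a4 d3 b4 x y m n =
    Q m n * (Gamma (z m) / Gamma g2) * (Gamma (w n) / Gamma g3).
  rewrite /D1_term (pochhammer_Gamma (a2 * m%:R) hg2).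
  rewrite (pochhammer_Gamma (b2 * n%:R) hg3).
  rewrite -/(z m) -/(w n) /Q; ring.
have D5E m n s : 0 < s < 1 ->
    cpow s (g2 - 1) * cpow (1 - s) (g3 - 1) *
    D5_term g1 a1 b1 (g2 + g3) a2 b2 d1 a3 b3 d2 a4 d3 b4
      (x * (s `^ a2)%:C) (y * ((1 - s) `^ b2)%:C) m n = t m n s.
  move=> s01; have /andP[s0 s1] := s01; have s1' : 0 < 1 - s by rewrite subr_gt0.
  rewrite /t betaK01E// /D5_term (pochhammer_Gamma _ hg23).
  have -> : g2 + g3 + (a2 * m%:R + b2 * n%:R)%:C = z m + w n.
    by rewrite rmorphD addrACA.
  have -> : z m - 1 = (g2 - 1) + (a2 * m%:R)%:C by rewrite addrAC.
  have -> : w n - 1 = (g3 - 1) + (b2 * n%:R)%:C by rewrite addrAC.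
  rewrite (cpowD (g2 - 1) _ s0) (cpowD (g3 - 1) _ s1') !cpow_real !powRrM.
  rewrite !powR_mulrn ?powR_ge0//.
  rewrite !rmorphXn !exprMn /K /Q; ring.
have it m n : cintegrable `]0%R, 1%R[%classic (t m n).
  apply: (cintegrableZ (K m n) mD).
  have [i1 i2] := cintegrable_betaK (zm0 m) (wn0 n).
  by split; apply: integrableS (_ : mu.-integrable setT _).
have tf s : (`]0%R, 1%R[%classic : set (measurableTypeR R)) s ->
    ccvgn (sqsum (fun m n => t m n s)) (f s).
  rewrite /= in_itv/= => s01.
  have := ccvgnZ (cpow s (g2 - 1) * cpow (1 - s) (g3 - 1))
    (abs_summable2_cvg (hD5 s s01)).
  congr (ccvgn _ _); apply/funext => N; rewrite -sqsumZ.
  apply: eq_bigr => m _; apply: eq_bigr => n _; exact: D5E.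
(* The integrals of the moduli of the terms: |Gamma (z m + w n)| B(p, q), where
   p and q are the real parts of z m and w n, is at most GammaR p * GammaR q,
   which the lower bounds for Gamma compare with |Gamma (z m) Gamma (w n)|, that
   is with the terms of D1. *)
have [c2 c20 Hc2] := Gamma_ge_real_Gamma (Im g2) hg2.
have [c3 c30 Hc3] := Gamma_ge_real_Gamma (Im g3) hg3.
have G2 := Gamma_neq0 hg2; have G3 := Gamma_neq0 hg3; have G23 := Gamma_neq0 hg23.
have [M HM] := abs_summable2_bound hD1.
pose C := normc (Gamma g2) * normc (Gamma g3) / (c2 * c3 * normc (Gamma (g2 + g3))).
have tM m n : \int[mu]_(s in `]0%R, 1%R[) normc (t m n s) <=
    C * normc (D1_term g1 a1 b1 g2 a2 g3 b2 d1 a3 b3 d2 a4 d3 b4 x y m n).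
  rewrite D1E; have -> : \int[mu]_(s in `]0%R, 1%R[) normc (t m n s) =
      normc (K m n) * \int[mu]_s betaKR (Re (z m)) (Re (w n)) s.
    rewrite -Rintegral01_betaKR -RintegralZl//; last first.
      by apply: integrableS (integrable_betaKR (zm0 m) (wn0 n)).
    by apply: eq_Rintegral => s _; rewrite ComplexField.Normc.normcM normc_betaK.
  have zwn0 : 0 < Re (z m + w n) by rewrite ReD addr_gt0.
  have := le_normc_Gamma zwn0; rewrite ReD => Gzw.
  have := Rintegral_betaKR (zm0 m) (wn0 n) => BG.
  have B0 : 0 <= \int[mu]_s betaKR (Re (z m)) (Re (w n)) s.
    by apply: Rintegral_ge0 => s _; exact: betaKR_ge0.
  have := Hc2 (z m) (Imz m); rewrite {1}zm lerDl => /(_ (am m)) Gz.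
  have := Hc3 (w n) (Imw n); rewrite {1}wn lerDl => /(_ (bn n)) Gw.
  have nM u v : normc (u * v) = normc u * normc v :> R.
    exact: ComplexField.Normc.normcM.
  have ndiv u v : normc (u / v) = normc u / normc v :> R.
    by rewrite nM ComplexField.Normc.normcV.
  have -> : normc (K m n) =
      normc (Q m n) * (normc (Gamma (z m + w n)) / normc (Gamma (g2 + g3))).
    by rewrite nM (ndiv (Gamma (z m + w n))).
  rewrite (nM (Q m n * _)) (nM (Q m n)).
  rewrite (ndiv (Gamma (z m))) (ndiv (Gamma (w n))) /C.
  have nG2 : 0 < normc (Gamma g2) by rewrite normc_gt0.
  have nG3 : 0 < normc (Gamma g3) by rewrite normc_gt0.
  have nG23 : 0 < normc (Gamma (g2 + g3)) by rewrite normc_gt0.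
  have nQ := normc_ge0 (Q m n).
  have Gp := GammaR_gt0 (zm0 m); have Gq := GammaR_gt0 (wn0 n).
  have -> : normc (Gamma g2) * normc (Gamma g3) /
       (c2 * c3 * normc (Gamma (g2 + g3))) *
     (normc (Q m n) * (normc (Gamma (z m)) / normc (Gamma g2)) *
       (normc (Gamma (w n)) / normc (Gamma g3))) =
     normc (Q m n) / normc (Gamma (g2 + g3)) *
       ((normc (Gamma (z m)) / c2) * (normc (Gamma (w n)) / c3)).
    by field; rewrite !gt_eqF.
  rewrite [normc (Gamma (z m + w n)) / _]mulrC !mulrA -!mulrA.
  apply: ler_wpM2l => //; apply: ler_wpM2l; first by rewrite invr_ge0 ltW.
  apply: (@le_trans _ _ (GammaR (Re (z m)) * GammaR (Re (w n)))).
    by rewrite -BG mulrC ler_wpM2l.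
  rewrite mulrA; apply: ler_pM; rewrite ?(ltW Gp) ?(ltW Gq)//.
    by rewrite ler_pdivlMr// mulrC.
  by rewrite ler_pdivlMr// mulrC.
have sM N : sqsum (fun m n => \int[mu]_(s in `]0%R, 1%R[) normc (t m n s)) N
    <= C * M.
  have C0 : 0 <= C by rewrite divr_ge0 ?mulr_ge0 ?normc_ge0// ltW.
  apply: le_trans (ler_wpM2l C0 (HM N)).
  rewrite /sqsum mulr_sumr; apply: ler_sum => m _.
  by rewrite mulr_sumr; apply: ler_sum => n _; exact: tM.
have [fi fc] := cintegral_sqsum mD it tf sM.
split; first exact: fi.
rewrite /D1 -(csum2Z _ fc); congr csum2.
apply/funext => m; apply/funext => n; rewrite D1E.
have -> : cintegral `]0%R, 1%R[%classic (t m n) =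
    K m n * cintegral setT (betaK (z m) (w n)).
  rewrite -cintegral01_betaK; apply: (cintegralZ (K m n) mD).
  have [i1 i2] := cintegrable_betaK (zm0 m) (wn0 n).
  by split; apply: integrableS (_ : mu.-integrable setT _).
transitivity (Q m n * (Gamma (z m) * Gamma (w n)) / (Gamma g2 * Gamma g3)).
  by field; apply/andP; split.
(* Here Euler's relation turns the Gamma factors of D1 into those of D5. *)
rewrite -(beta_Gamma (zm0 m) (wn0 n)) /K; field.
by rewrite G2 G3 G23.
Qed.
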